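(* Let $\mathbf{k}$ be a perfect field and $S$ a non-trivial Severi–Brauer surface over $\mathbf{k}$. The determinant map $\det:\mathrm{Aut}_{\mathbf{k}}(S)\to\mathbf{k}^*/(\mathbf{k}^* )^3$ is the abelianization of $\mathrm{Aut}_{\mathbf{k}}(S)$, i.e. its kernel is the commutator subgroup of $\mathrm{Aut}_{\mathbf{k}}(S)$, so that it induces an isomorphism from the abelianization of $\mathrm{Aut}_{\mathbf{k}}(S)$ onto the image of $\det$.
   Context: A Severi–Brauer surface over $\mathbf{k}$ is a smooth projective surface $S$ with $S_{\bar{\mathbf{k}}}\simeq\mathbb{P}^2_{\bar{\mathbf{k}}}$; it is non-trivial if it is not $\mathbf{k}$-isomorphic to $\mathbb{P}^2_{\mathbf{k}}$. Determinant: let $\mathbf{k}\subset \mathbf{L}$ be a finite Galois extension with an $\mathbf{L}$-isomorphism $\varphi:S_{\mathbf{L}}\to\mathbb{P}^2_{\mathbf{L}}$, and choose $A_g\in \mathrm{GL}_3(\mathbf{L})$ with $\varphi\circ g\circ\varphi^{-1}=[A_g]\circ g$ for $g\in \mathrm{Gal}(\mathbf{L}/\mathbf{k})$. For $\alpha\in \mathrm{Aut}_{\mathbf{k}}(S)$ there is $A\in \mathrm{GL}_3(\mathbf{L})$, unique up to $\mathbf{k}^*$, representing $\varphi\alpha\varphi^{-1}$ with $A^g=A_g^{-1}AA_g$ for all $g$ ($A^g$: apply $g$ to the entries). Then $\det(A)\in\mathbf{k}^*$, and $\det(\alpha)$ is its class in $\mathbf{k}^*/(\mathbf{k}^* )^3$;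 it is independent of the choices and defines a group homomorphism. *)

(* Defs.v *)
From HB Require Import structures.
From mathcomp Require Import all_boot all_order all_algebra all_fingroup all_field.
From mathcomp Require Import generic_quotient boolp classical_sets.
From mathcomp Require Import mpoly.

Set Implicit Arguments.
Unset Strict Implicit.
Unset Printing Implicit Defensive.

Import GRing.Theory.

Local Open Scope quotient_scope.
Local Open Scope classical_set_scope.
Local Open Scope ring_scope.

Section Groups.
Local Open Scope group_scope.

Definition subgroup (G : groupType) (H : set G) : Prop :=
  [/\ H 1, forall x y, H x -> H y -> H (x * y) & forall x, H x -> H x^-1].

Record normalSubgroup (G : groupType) := NormalSubgroup {
  nsub :> G -> Prop;
  nsub_subgroup : subgroup nsub;
  nsub_conj : forall x y, nsub x -> nsub (x ^ y)
}.

Definition commutator_subgroup (G : groupType) : set G :=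
  fun x => forall H : set G,
    subgroup H -> (forall a b, H [~ a, b]) -> H x.

Section Quotient.
Variables (G : groupType) (N : normalSubgroup G).

Definition coset_rel : rel G := fun x y => `[< N (x * y^-1) >].

Lemma coset_rel_equiv : equiv_class_of coset_rel.
Proof.
have [N1 NM NV] := nsub_subgroup N.
split=> [x|x y|y x z].
- by apply/asboolP; rewrite mulgV.
- by apply/asboolP/asboolP => /NV; rewrite invgM invgK.
- by move=> /asboolP xy /asboolP yz; apply/asboolP; move: (NM _ _ xy yz);
    rewrite mulgA mulgVK.
Qed.

Canonical coset_equiv := EquivRelPack coset_rel_equiv.

Definition quotGroup := {eq_quot coset_rel}.
HB.instance Definition _ := Choice.on quotGroup.
HB.instance Definition _ := EqQuotient.on quotGroup.

Definition quotMap (x : G) : quotGroup := \pi x.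

Lemma quot_mapP x y :
  quotMap x = quotMap y <-> N (x * y^-1).
Proof.
rewrite /quotMap; split; last by move=> h; apply/eqmodP/asboolP.
by move/eqmodP/asboolP.
Qed.

Definition quot_one : quotGroup := quotMap 1.
Definition quot_mul (a b : quotGroup) : quotGroup :=
  quotMap (repr a * repr b).
Definition quot_inv (a : quotGroup) : quotGroup :=
  quotMap (repr a)^-1.

Lemma quot_mapK a : quotMap (repr a) = a.
Proof. exact: reprK. Qed.

Lemma repr_quotMap x : N (repr (quotMap x) * x^-1).
Proof. by apply/quot_mapP; rewrite quot_mapK. Qed.

Lemma quot_mapM x y :
  quotMap (x * y) = quot_mul (quotMap x) (quotMap y).
Proof.
have [N1 NM NV] := nsub_subgroup N.
apply/esym/quot_mapP; set a := repr _; set b := repr _.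
have hx : N (a * x^-1) := repr_quotMap x.
have hy : N (b * y^-1) := repr_quotMap y.
have -> : a * b * (x * y)^-1 = (b * y^-1) ^ a^-1 * (a * x^-1).
  by rewrite /conjg invgK invgM !mulgA mulgVK.
by apply: NM => //; apply: nsub_conj.
Qed.

Lemma quot_mapV x :
  quotMap x^-1 = quot_inv (quotMap x).
Proof.
have [N1 NM NV] := nsub_subgroup N.
apply/esym/quot_mapP; set a := repr _.
have hx : N (a * x^-1) := repr_quotMap x.
have -> : a^-1 * x^-1^-1 = ((a * x^-1)^-1) ^ a.
  by rewrite /conjg !invgM !invgK mulgVK.
by apply: nsub_conj; apply: NV.
Qed.

Lemma quot_mulA : associative quot_mul.
Proof.
move=> a b c; rewrite -[a]quot_mapK -[b]quot_mapK -[c]quot_mapK.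
by rewrite -!quot_mapM mulgA.
Qed.
Lemma quot_mul1 : left_id quot_one quot_mul.
Proof. by move=> a; rewrite -[a]quot_mapK -quot_mapM mul1g. Qed.
Lemma quot_mulr1 : right_id quot_one quot_mul.
Proof. by move=> a; rewrite -[a]quot_mapK -quot_mapM mulg1. Qed.
Lemma quot_mulV : left_inverse quot_one quot_inv quot_mul.
Proof.
by move=> a; rewrite -[a]quot_mapK -quot_mapV -quot_mapM mulVg.
Qed.
Lemma quot_mulrV : right_inverse quot_one quot_inv quot_mul.
Proof.
by move=> a; rewrite -[a]quot_mapK -quot_mapV -quot_mapM mulgV.
Qed.

HB.instance Definition _ := isGroup.Build quotGroup
  quot_mulA quot_mul1 quot_mulr1 quot_mulV quot_mulrV.

End Quotient.

Section Abelianization.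
Variable G : groupType.

Lemma commutator_subgroup_subgroup : subgroup (@commutator_subgroup G).
Proof.
split=> [H [] //|x y hx hy H sH cH|x hx H sH cH]; have [H1 HM HV] := sH.
- by apply: HM; [apply: hx | apply: hy].
- by apply: HV; apply: hx.
Qed.

Lemma commutator_subgroup_conj x y :
  commutator_subgroup x -> @commutator_subgroup G (x ^ y).
Proof.
move=> hx H sH cH; have [H1 HM HV] := sH.
apply: (hx (fun z => H (z ^ y))); last by move=> a b; rewrite conjRg.
split=> [|u v hu hv|u hu]; rewrite ?conj1g ?conjMg ?conjVg //.
- exact: HM.
- exact: HV.
Qed.

Definition derived_subgroup : normalSubgroup G :=
  NormalSubgroup commutator_subgroup_subgroup commutator_subgroup_conj.

Definition abelianization := quotGroup derived_subgroup.

End Abelianization.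
End Groups.

Section UnitGroup.
Variable F : fieldType.

Definition fstar := {x : F | x != 0}.
HB.instance Definition _ := Choice.on fstar.

Definition fstar_one : fstar := exist _ 1 (oner_neq0 F).
Definition fstar_mul (x y : fstar) : fstar :=
  exist _ (val x * val y) (mulf_neq0 (valP x) (valP y)).
Lemma fstar_inv_subproof (x : fstar) : (val x)^-1 != 0.
Proof. by rewrite invr_eq0 (valP x). Qed.
Definition fstar_inv (x : fstar) : fstar := 
  exist _ (val x)^-1 (fstar_inv_subproof x).

Lemma fstar_mulA : associative fstar_mul.
Proof. by move=> x y z; apply: val_inj; rewrite /= mulrA. Qed.
Lemma fstar_mulC : commutative fstar_mul.
Proof. by move=> x y; apply: val_inj; rewrite /= mulrC. Qed.
Lemma fstar_mul1 : left_id fstar_one fstar_mul.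
Proof. by move=> x; apply: val_inj; rewrite /= mul1r. Qed.
Lemma fstar_mulr1 : right_id fstar_one fstar_mul.
Proof. by move=> x; rewrite fstar_mulC fstar_mul1. Qed.
Lemma fstar_mulV : left_inverse fstar_one fstar_inv fstar_mul.
Proof. by move=> x; apply: val_inj; rewrite /= mulVf // (valP x). Qed.
Lemma fstar_mulrV : right_inverse fstar_one fstar_inv fstar_mul.
Proof. by move=> x; rewrite fstar_mulC fstar_mulV. Qed.

HB.instance Definition _ := isGroup.Build fstar
  fstar_mulA fstar_mul1 fstar_mulr1 fstar_mulV fstar_mulrV.

Local Open Scope group_scope.

Definition is_cube : set fstar := [set x | exists y : fstar, x = y ^+ 3].

Lemma is_cube_subgroup : subgroup is_cube.
Proof.
split=> [|_ _ [x ->] [y ->]|_ [x ->]].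
- by exists 1; rewrite expg1n.
- by exists (x * y); rewrite expgMn //; apply: fstar_mulC.
- by exists x^-1; rewrite expVgn.
Qed.

Lemma is_cube_conj x y : is_cube x -> is_cube (x ^ y).
Proof. by move=> [z ->]; exists (z ^ y); rewrite conjXg. Qed.

Definition cubes : normalSubgroup fstar :=
  NormalSubgroup is_cube_subgroup is_cube_conj.

End UnitGroup.

Definition perfect_field (k : fieldType) : Prop :=
  forall p : {poly k}, irreducible_poly p -> separable_poly p.

Definition algebraic_closure (k : fieldType) (K : closedFieldType)
  (iota : {rmorphism k -> K}) : Prop := forall x : K, algebraicOver iota x.

Section ProjectiveSpace.
Variable K : fieldType.

(* P^n(K), as the set of lines of K^(n+1). *)
Definition proj (n : nat) := {U : {vspace 'cV[K]_n.+1} | \dim U == 1%N}.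

(* v is a vector of homogeneous coordinates of x. *)
Definition hcoord n (x : proj n) (v : 'cV[K]_n.+1) : bool :=
  (v != 0) && (v \in val x).

Definition P2 : set (proj 2) := [set: proj 2].

End ProjectiveSpace.

Arguments P2 K : clear implicits.

(* Classical varieties over a subfield e : F -> K of an algebraically closed  *)
(* field K: a projective variety is identified with its set of K-points, with *)
(* its reduced structure, and a morphism with the map it induces on K-points. *)
Section Varieties.
Variables (F K : fieldType) (e : {rmorphism F -> K}).

Definition peval n (p : {mpoly F[n]}) (v : 'cV[K]_n) : K :=
  mmap e (fun i => v i 0) p.

Definition pevals n m (G : 'I_m -> {mpoly F[n]}) (v : 'cV[K]_n) : 'cV[K]_m :=
  \col_i peval (G i) v.

Definition defined_over n (X : set (proj K n)) : Prop :=
  exists2 s : seq {mpoly F[n.+1]},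
    forall p, p \in s -> exists d : nat, p \is d.-homog
  & forall x, X x <->
      (forall p v, p \in s -> hcoord x v -> peval p v = 0).

(* A map is a morphism over F when around each point it has the form          *)
(* x |-> [G_0(x) : ... : G_m(x)] with G_i homogeneous over F, of one degree.  *)
Definition morphism_over n m (X : set (proj K n)) (Y : set (proj K m))
    (f : X -> Y) : Prop :=
  forall x : X, exists (d : nat) (G : 'I_m.+1 -> {mpoly F[n.+1]}),
    [/\ forall i, G i \is d.-homog,
        forall v, hcoord (val x) v -> pevals G v != 0
      & forall (y : X) v, hcoord (val y) v -> pevals G v != 0 ->
          hcoord (val (f y)) (pevals G v)].

Record isomorphism n m (X : set (proj K n)) (Y : set (proj K m)) :=
  Isomorphism {
    iso_fun :> X -> Y;
    iso_inv : Y -> X;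
    iso_funK : cancel iso_fun iso_inv;
    iso_invK : cancel iso_inv iso_fun;
    iso_fun_morphism : morphism_over iso_fun;
    iso_inv_morphism : morphism_over iso_inv
  }.

Lemma morphism_over_id n (X : set (proj K n)) : morphism_over (fun x : X => x).
Proof.
move=> x; exists 1%N, (fun i => 'X_i).
have E v : pevals (fun i => 'X_i) v = v.
  by apply/colP=> i; rewrite !mxE /peval mmapX mmap1U.
split=> [i|v|y v]; rewrite ?E //; last by case/andP.
by rewrite dhomogX /= mdeg1.
Qed.

Lemma dhomog_comp n m (p : {mpoly F[m]}) (G : m.-tuple {mpoly F[n]}) d d' :
  p \is d'.-homog -> (forall i, tnth G i \is d.-homog) ->
  p \mPo G \is (d * d').-homog.
Proof.
move=> /dhomogP hp hG; rewrite comp_mpolyEX big_seq; apply: rpred_sum => u us.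
apply: dhomogZ; rewrite comp_mpolyX -(hp u us) /= mdegE big_distrr /=.
elim: (index_enum _) => [|i r IH]; rewrite !(big_nil, big_cons).
  exact: dhomog1.
by apply: dhomogM IH; apply: dhomogMn.
Qed.

Lemma peval_comp n m (p : {mpoly F[m]}) (G : 'I_m -> {mpoly F[n]}) v :
  peval (p \mPo [tuple G i | i < m]) v = peval p (pevals G v).
Proof.
rewrite comp_mpolyEX /peval [in RHS](mpolyE p) !raddf_sum /=.
apply: eq_bigr => u _; rewrite !mmapZ; congr (_ * _).
rewrite mmapX comp_mpolyX rmorph_prod /= /mmap1; apply: eq_bigr => i _.
by rewrite rmorphXn /= tnth_mktuple mxE.
Qed.

Lemma peval_scale n (p : {mpoly F[n]}) d c v :
  p \is d.-homog -> peval p (c *: v) = c ^+ d * peval p v.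
Proof.
move=> /dhomogP hp; rewrite /peval [p]mpolyE !raddf_sum /= big_distrr /=.
rewrite !big_seq; apply: eq_bigr => u us; rewrite !mmapZ !mmapX mulrCA.
congr (_ * _); rewrite -(hp u us) /= mdegE /mmap1 -prodrXr -big_split /=.
by apply: eq_bigr => i _; rewrite mxE exprMn.
Qed.

Lemma hcoord_scale n (x : proj K n) v w :
  hcoord x v -> hcoord x w -> exists2 c, c != 0 & w = c *: v.
Proof.
move=> /andP[v0 vx] /andP[w0 wx].
have /eqP xv : <[v]>%VS == val x.
  by rewrite eqEdim -memvE vx (eqP (valP x)) dim_vline v0.
move: wx; rewrite -xv => /vlineP[c wE]; exists c => //.
by apply: contraNneq w0 => c0; rewrite wE c0 scale0r.
Qed.

Lemma morphism_over_comp n m l (X : set (proj K n)) (Y : set (proj K m))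
    (Z : set (proj K l)) (g : Y -> Z) (f : X -> Y) :
  morphism_over g -> morphism_over f -> morphism_over (fun x => g (f x)).
Proof.
move=> mg mf x; have [d [G [hG Gx Gf]]] := mf x.
have [d' [H [hH Hx Hg]]] := mg (f x).
have [v xv] : exists v, hcoord (val x) v.
  exists (vpick (val (val x))); rewrite /hcoord memv_pick andbT vpick0.
  by rewrite -dimv_eq0 (eqP (valP (val x))).
have /matrix0Pn [i [j]] := Gx v xv; rewrite ord1 mxE => Gi.
exists (d + d * d')%N, (fun a => G i * (H a \mPo [tuple G b | b < _])).
have E w : pevals (fun a => G i * (H a \mPo [tuple G b | b < _])) w
    = peval (G i) w *: pevals H (pevals G w).
  apply/colP=> a; rewrite !mxE -peval_comp /peval rmorphM /=.
  by [].
split=> [a|w xw|y w yw].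
- apply: dhomogM => //; apply: dhomog_comp => // b.
  by rewrite tnth_mktuple.
- rewrite E scaler_eq0 negb_or Hx ?andbT; last by apply: Gf => //; apply: Gx.
  have [c c0 ->] := hcoord_scale xv xw.
  by rewrite (peval_scale _ _ (hG i)) mulf_neq0 // expf_neq0.
- rewrite E scaler_eq0 negb_or => /andP[Giw HGw].
  have Gw : pevals G w != 0.
    by apply: contraNneq Giw => /colP/(_ i); rewrite !mxE => ->.
  have /andP[u0 uz] := Hg (f y) _ (Gf y w yw Gw) HGw.
  by rewrite /hcoord scaler_eq0 negb_or Giw u0 memvZ.
Qed.

Section Automorphisms.
Variables (n : nat) (X : set (proj K n)).

Definition varAut := isomorphism X X.
HB.instance Definition _ := gen_eqMixin varAut.
HB.instance Definition _ := gen_choiceMixin varAut.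

Lemma varAut_ext (f g : varAut) : f =1 g -> f = g.
Proof.
case: f g => [f f' fK f'K mf mf'] [g g' gK g'K mg mg'] /= /funext fg.
have f'g' : f' = g'.
  by apply/funext => x; rewrite -[x in LHS]g'K -[X in f' (X _)]fg fK.
by move: fK f'K mf mf' gK g'K mg mg'; rewrite fg f'g' => *;
  congr Isomorphism; apply: Prop_irrelevance.
Qed.

Definition varAut_one : varAut :=
  @Isomorphism _ _ X X (fun x => x) (fun x => x) (fun=> erefl) (fun=> erefl)
    (@morphism_over_id _ X) (@morphism_over_id _ X).

Definition varAut_inv (f : varAut) : varAut :=
  Isomorphism (iso_invK f) (iso_funK f)
    (iso_inv_morphism f) (iso_fun_morphism f).

Definition varAut_mul (f g : varAut) : varAut :=
  @Isomorphism _ _ X X (fun x => f (g x)) (fun x => iso_inv g (iso_inv f x))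
    (can_comp (iso_funK f) (iso_funK g)) (can_comp (iso_invK g) (iso_invK f))
    (morphism_over_comp (iso_fun_morphism f) (iso_fun_morphism g))
    (morphism_over_comp (iso_inv_morphism g) (iso_inv_morphism f)).

Lemma varAut_mulA : associative varAut_mul.
Proof. by move=> f g h; apply: varAut_ext. Qed.
Lemma varAut_mul1 : left_id varAut_one varAut_mul.
Proof. by move=> f; apply: varAut_ext. Qed.
Lemma varAut_mulr1 : right_id varAut_one varAut_mul.
Proof. by move=> f; apply: varAut_ext. Qed.
Lemma varAut_mulV : left_inverse varAut_one varAut_inv varAut_mul.
Proof. by move=> f; apply: varAut_ext => x; apply: iso_funK. Qed.
Lemma varAut_mulrV : right_inverse varAut_one varAut_inv varAut_mul.
Proof. by move=> f; apply: varAut_ext => x; apply: iso_invK. Qed.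

HB.instance Definition _ := isGroup.Build varAut
  varAut_mulA varAut_mul1 varAut_mulr1 varAut_mulV varAut_mulrV.

End Automorphisms.
End Varieties.

Section SeveriBrauer.
Variables (k : fieldType) (K : closedFieldType) (iota : {rmorphism k -> K}).
Variables (n : nat) (S : set (proj K n)).

(* K is meant to be an algebraic closure of k. Smoothness and dimension 2 are *)
(* consequences of the isomorphism with P^2 over K.                           *)
Definition Severi_Brauer_surface : Prop :=
  defined_over iota S /\
  inhabited (isomorphism (idfun : {rmorphism K -> K}) S (P2 K)).

Definition trivial_Severi_Brauer : Prop :=
  inhabited (isomorphism iota S (P2 K)).

Variables (L : splittingFieldType k) (j : {rmorphism L -> K}).
Variables (phi : isomorphism j S (P2 K)) (A_ : gal_of {:L} -> 'M[L]_3).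

(* phi o g o phi^-1 = [A_g] o g, where g acts on K-points through any         *)
(* automorphism s of K extending it: phi (s x) = [A_g] (s (phi x)).           *)
Definition descent_matrices : Prop :=
  forall g : gal_of {:L}, g \in 'Gal({:L} / 1)%g ->
    A_ g \in unitmx /\
    forall s : {rmorphism K -> K}, (forall a, s (j a) = j (g a)) ->
    forall x y : S,
      (forall u, hcoord (val x) u -> hcoord (val y) (map_mx s u)) ->
    forall v, hcoord (val (phi x)) v ->
      hcoord (val (phi y)) (map_mx j (A_ g) *m map_mx s v).

(* A represents phi o alpha o phi^-1, with A^g = A_g^-1 A A_g for all g. *)
Definition represents (alpha : varAut iota S) (A : 'M[L]_3) : Prop :=
  [/\ A \in unitmx,
      forall (x : S) v, hcoord (val (phi x)) v ->
        hcoord (val (phi (alpha x))) (map_mx j A *m v)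
    & forall g : gal_of {:L}, g \in 'Gal({:L} / 1)%g ->
        map_mx g A = invmx (A_ g) *m A *m A_ g].

Definition is_SB_det (alpha : varAut iota S)
    (d : quotGroup (cubes k)) : Prop :=
  exists (A : 'M[L]_3) (c : fstar k),
    [/\ represents alpha A, \det A = (val c)%:A & d = quotMap (cubes k) c].

(* When L / k is Galois with descent matrices A_, is_SB_det alpha is a       *)
(* singleton and the default value 1 is irrelevant.                           *)
Definition SB_det (alpha : varAut iota S) : quotGroup (cubes k) :=
  xget 1%g (is_SB_det alpha).

End SeveriBrauer.

(* Main.v *)
(* Aut_k(S) is D^* / k^*, where D is the k-algebra of the matrices M over L with
   A_g g(M) = M A_g: automorphisms of P^2 are linear because the polynomial ring
   is factorial, Hilbert 90 normalises the matrix of an automorphism of S, and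
   Galois-equivariant morphisms over L descend to k. A singular nonzero element
   of D would give a Galois-stable line, hence, by Hilbert 90 for GL_3, an
   isomorphism of S with P^2 over k; so D is a division algebra. Let a in D be
   non-central with det a = 1, and set v = [a, w] <> 0. For a suitable r in k the
   elements x = (r - a)^-1 v (or x = v) and y = x a have the same characteristic
   polynomial, so x z = z y for some nonzero z in D, and a = [x, z]. *)

Require Import Defs.
From HB Require Import structures.
From mathcomp Require Import all_boot all_order all_algebra all_fingroup all_field.
From mathcomp Require Import boolp classical_sets.
From mathcomp Require Import mpoly zify ring.

Set Implicit Arguments.
Unset Strict Implicit.
Unset Printing Implicit Defensive.

Import GRing.Theory.

Local Open Scope ring_scope.

(** Why [r] exists: take x = q v with q commuting with a. Then x and x a both have trace zero,
    because v is a commutator with a, and they have the same determinant because det a = 1. Only the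
    traces of their inverses remain to be matched, a condition linear in q^-1, and q^-1 = r - a
    offers the one parameter needed to meet it. The obstacle elsewhere is scalars. The matrices
    [A_ g] form a cocycle only up to scalars, so Hilbert 90 does not apply to them directly: it is
    applied after a stable line has fixed the scalars, or to a cocycle of scalars. Since varieties
    are sets of K-points, Galois automorphisms must first be extended to K, and matrix identities
    are obtained, up to a scalar, by comparing images of L-rational points. One device serves
    Hilbert 90, the L-span of D and the descent of morphisms: weights m_i, e_i in L whose sum of m_i
    g(e_i) is 1 for g = 1 and 0 otherwise. They recover an object from its Galois averages. *)

(** * Extending field embeddings to an algebraic closure *)

Lemma algebraicOver_inv (L K : fieldType) (j : {rmorphism L -> K}) (x : K) :
  algebraicOver j x -> x != 0 ->
  exists q : {poly L}, (map_poly j q).[x] = x^-1.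
Proof.
move=> [p p0 rp] x0; move: p p0 rp; elim/poly_ind => [|q c IH] p0 rp.
  by rewrite eqxx in p0.
have e : (map_poly j q).[x] * x + j c = 0.
  by move/rootP: rp; rewrite rmorphD rmorphM /= map_polyX map_polyC /= !hornerE.
have [c0|c0] := eqVneq c 0.
  apply: IH.
    by apply: contraNneq p0 => q0; rewrite q0 c0 mul0r addr0.
  move: e; rewrite c0 rmorph0 addr0 => /eqP; rewrite mulf_eq0 (negPf x0) orbF.
  by move/eqP/rootP.
exists (- c^-1 *: q); rewrite map_polyZ hornerZ rmorphN fmorphV.
have jc : j c != 0 by rewrite fmorph_eq0.
apply: (mulIf x0); rewrite mulVf // -mulrA.
have -> : (map_poly j q).[x] * x = - j c by apply/eqP; rewrite -addr_eq0 e.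
by rewrite mulrNN mulVf.
Qed.

(* A field morphism is encoded by its graph, a subring of K * K on which the
   first projection is injective; Zorn provides a maximal graph. *)
Lemma extend_to_closure (L : fieldType) (K : closedFieldType)
    (j j' : {rmorphism L -> K}) :
  (forall x, algebraicOver j x) ->
  exists s : {rmorphism K -> K}, forall a, s (j a) = j' a.
Proof.
move=> alg; pose gr a : K * K := (j a, j' a).
have grB a b : gr (a - b) = gr a - gr b by rewrite /gr !rmorphB.
have grM a b : gr (a * b) = gr a * gr b by rewrite /gr !rmorphM.
have gr1 : gr 1 = 1 by rewrite /gr !rmorph1.
(* The third clause asks for stability under adding [gr a], not for [gr a] itself: the union of the
   empty chain is empty and must satisfy [P]. Nonemptiness of the maximal graph is recovered
   below. *)
pose P (R : set (K * K)) :=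
  [/\ forall x y, R x -> R y -> R (x - y),
      forall x y, R x -> R y -> R (x * y),
      forall x a, R x -> R (x + gr a)
    & forall y, R (0, y) -> y = 0].
have [F FP Ftot|A [[AB AM Agr A0] Amax]] := @Zorn_bigcup _ P.
  split=> [x y|x y|x a|y].
  - move=> [X FX Xx] [Y FY Yy].
    by have [XY|YX] := Ftot X Y FX FY; [exists Y|exists X] => //;
      [have [H _ _ _] := FP Y FY | have [H _ _ _] := FP X FX]; apply: H; auto.
  - move=> [X FX Xx] [Y FY Yy].
    by have [XY|YX] := Ftot X Y FX FY; [exists Y|exists X] => //;
      [have [_ H _ _] := FP Y FY | have [_ H _ _] := FP X FX]; apply: H; auto.
  - by move=> [X FX Xx]; exists X => //; have [_ _ H _] := FP X FX; apply: H.
  - by move=> [X FX Xx]; have [_ _ _ H] := FP X FX; apply: H.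
have [z Az] : exists z, A z.
  apply: contrapT => nA; apply: (Amax (fun z => exists a, z = gr a)).
    split; first by move=> z Az; case: nA; exists z.
    by move=> /(_ (gr 0) (ex_intro _ 0 erefl)) h; apply: nA; exists (gr 0).
  split=> [x y|x y|x a|y].
  - by move=> [a ->] [b ->]; exists (a - b).
  - by move=> [a ->] [b ->]; exists (a * b).
  - by move=> [b ->]; exists (b + a); rewrite /gr !rmorphD.
  - move=> [a [h ->]]; have /eqP := esym h; rewrite fmorph_eq0 => /eqP ->.
    by rewrite rmorph0.
have A_0 : A 0 by rewrite -(subrr z); apply: (@AB).
clear z Az; have A_gr a : A (gr a) by rewrite -[gr a]add0r; apply: Agr.
have A_1 : A 1 by rewrite -gr1.
have AD x y : A x -> A y -> A (x + y).
  by move=> Ax Ay; rewrite -[y]opprK -[- y]add0r; apply: (@AB) => //; apply: (@AB).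
have A_sum n (F : 'I_n -> K * K) : (forall i, A (F i)) -> A (\sum_i F i).
  by move=> h; apply: big_ind.
have Afst x y y' : A (x, y) -> A (x, y') -> y = y'.
  move=> h h'; have : A (x - x, y - y') := AB _ _ h h'.
  rewrite subrr => /A0/eqP.
  by rewrite subr_eq0 => /eqP.
pose AP (f : {poly K * K}) := forall i, A f`_i.
have APB f g : AP f -> AP g -> AP (f - g).
  by move=> hf hg i; rewrite coefB; apply: (@AB).
have APM f g : AP f -> AP g -> AP (f * g).
  by move=> hf hg i; rewrite coefM; apply: A_sum => l; apply: (@AM).
have APC c : A c -> AP c%:P by move=> hc i; rewrite coefC; case: eqP.
have APX : AP 'X by move=> i; rewrite coefX; case: eqP.
have APXn i : AP 'X^i by move=> l; rewrite coefXn; case: eqP.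
have APgr (q : {poly L}) : AP (map_poly gr q).
  by move=> i; rewrite coef_map_id0 // /gr !rmorph0.
have evfst (f : {poly K * K}) x y : f.[(x, y)].1 = (map_poly fst f).[x].
  by rewrite -[x in RHS]/((x, y).1) horner_map.
have evsnd (f : {poly K * K}) x y : f.[(x, y)].2 = (map_poly snd f).[y].
  by rewrite -[y in RHS]/((x, y).2) horner_map.
have fstgr q : map_poly fst (map_poly gr q) = map_poly j q.
  by apply/polyP => i; rewrite coef_map /= coef_map_id0 ?coef_map // /gr !rmorph0.
have evA f z : AP f -> A z -> A f.[z].
  move=> hf hz; rewrite horner_coef; apply: A_sum => i; apply: (@AM) => //.
  by elim: (val i) => [|m IH]; rewrite ?expr0 // exprS; apply: (@AM).
(* The inverse is a polynomial in [z] itself, since [z.1] is algebraic; the maximal graph is thus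
   already a field. *)
have Ainv z : A z -> z.1 != 0 -> exists2 z', A z' & z' * z = 1.
  move=> Az z0; have [q qz] := algebraicOver_inv (alg z.1) z0.
  exists (map_poly gr q).[z]; first exact: evA.
  have h1 : ((map_poly gr q).[z] * z).1 = 1.
    by rewrite {1 2}[z]surjective_pairing [LHS]/= evfst fstgr qz mulVf.
  rewrite [LHS]surjective_pairing h1.
  congr (_, _); apply: (Afst 1) => //.
  by rewrite -h1 -surjective_pairing; apply: (@AM) => //; apply: evA.
have A_total x : exists y, A (x, y).
  (* A monic [f] over the graph, of least degree with first projection killing [x], acts as minimal
     polynomial, and [y] is a root of its second projection. Euclidean division by [f], in [key],
     shows that adjoining [(x, y)] keeps the first projection injective. *)
  pose Q d := `[< exists f, [/\ AP f, f \is monic, (map_poly fst f).[x] = 0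
                              & size f = d] >].
  have exQ : exists d, Q d.
    have [p p0 rp] := alg x; pose p' := (lead_coef p)^-1 *: p.
    exists (size (map_poly gr p')); apply/asboolP.
    exists (map_poly gr p'); split=> //.
      apply/monicP; rewrite lead_coef_map_id0 ?/gr ?rmorph0 //.
        by rewrite lead_coefZ mulVf ?lead_coef_eq0 ?rmorph1.
      by rewrite lead_coefZ mulVf ?lead_coef_eq0 // !rmorph1 oner_neq0.
    by rewrite fstgr map_polyZ hornerZ (rootP rp) mulr0.
  have [d /asboolP[f [Af fm fx fd]] dmin] := ex_minnP exQ.
  have szs : size (map_poly snd f) = size f.
    by rewrite size_map_poly_id0 // (monicP fm) /= oner_neq0.
  have szf : size f != 1%N.
    apply/eqP => /eqP s1; move: fx; have /size_poly1P [c c0 fc] := s1.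
    move: fm; rewrite fc => /monicP; rewrite lead_coefC => ->.
    by rewrite map_polyC hornerC /= => /eqP; rewrite oner_eq0.
  have [y /rootP fy] : exists y, root (map_poly snd f) y.
    by apply/closed_rootP; rewrite szs.
  have key h : AP h -> (map_poly fst h).[x] = 0 -> (map_poly snd h).[y] = 0.
    elim: {h}(size h) {-2}h (leqnn (size h)) => [|m IH] h hm Ah hx.
      by move: hm; rewrite leqn0 size_poly_eq0 => /eqP ->;
        rewrite map_poly0 horner0.
    have [->|h0] := eqVneq h 0; first by rewrite map_poly0 horner0.
    have Alc : A (lead_coef h) by apply: Ah.
    have lc0 : (lead_coef h).1 != 0.
      apply/eqP => h1; have : lead_coef h = 0.
        rewrite [lead_coef h]surjective_pairing h1; congr (_, _).
        by apply: A0; rewrite -h1 -surjective_pairing.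
      by move/eqP; rewrite lead_coef_eq0 (negPf h0).
    (* A nonzero [h] shorter than [f] could be made monic, against the minimality of [d]. *)
    have [hf|fh] := ltnP (size h) (size f).
      have [z' Az' z'h] := Ainv _ Alc lc0.
      have : Q (size (z'%:P * h)).
        apply/asboolP; exists (z'%:P * h); split=> //.
        - by apply: (@APM) => //; apply: (@APC).
        - apply/monicP; rewrite mul_polyC lead_coefE.
          have sz : size (z' *: h) = size h.
            apply/eqP; rewrite eqn_leq size_scale_leq /=.
            have : (z' *: h)`_(size h).-1 != 0.
              by rewrite coefZ -lead_coefE z'h oner_neq0.
            apply: contraR; rewrite -ltnNge => hh; apply/eqP.
            by rewrite nth_default // -ltnS prednK ?size_poly_gt0.
          by rewrite sz coefZ -lead_coefE z'h.
        - by rewrite rmorphM /= hornerM hx mulr0.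
      move/dmin; rewrite -fd => h1.
      have := leq_trans hf h1.
      by rewrite mul_polyC ltnNge size_scale_leq.
    pose g := h - (lead_coef h)%:P * 'X^(size h - size f) * f.
    have Ag : AP g by apply: (@APB) => //; apply: (@APM) => //;
      apply: (@APM) => //; apply: (@APC).
    have gm : (size g <= m)%N.
      rewrite -ltnS; apply: leq_trans hm.
      have sf0 : (0 < size f)%N by rewrite size_poly_gt0 monic_neq0.
      have sh0 : (0 < size h)%N by rewrite size_poly_gt0.
      rewrite -(prednK sh0) ltnS; apply/leq_sizeP => i hi.
      rewrite /g coefB -mulrA mul_polyC coefZ coefXnM.
      case: ltnP => [hlt|hge].
        by rewrite nth_default ?mulr0 ?subr0 //; lia.
      have [->|ne] := eqVneq i (size h).-1.
        have -> : ((size h).-1 - (size h - size f) = (size f).-1)%N by lia.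
        by rewrite -!lead_coefE (monicP fm) mulr1 subrr.
      have hi1 : (size h <= i)%N by lia.
      have hi2 : (size f <= i - (size h - size f))%N by lia.
      by rewrite [h`_i]nth_default // [f`__]nth_default // mulr0 subr0.
    have -> : h = g + (lead_coef h)%:P * 'X^(size h - size f) * f by rewrite subrK.
    rewrite rmorphD /= hornerD IH //; first
      by rewrite rmorphM /= hornerM fy mulr0 addr0.
    by rewrite /g rmorphB /= hornerD hornerN hx rmorphM /= hornerM fx mulr0 subr0.
  exists y; apply: contrapT => nA.
  apply: (Amax (fun z => exists2 f, AP f & z = f.[(x, y)])).
    split; first by move=> z Az; exists z%:P; rewrite ?hornerC //; apply: (@APC).
    by move=> /(_ (x, y)) h; apply: nA; apply: h; exists 'X; rewrite ?hornerX.
  split=> [z t [h Ah ->] [h' Ah' ->]|z t [h Ah ->] [h' Ah' ->]|z a [h Ah ->]|t].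
  - by exists (h - h'); rewrite ?hornerD ?hornerN //; apply: (@APB).
  - by exists (h * h'); rewrite ?hornerM //; apply: (@APM).
  - exists (h + (gr a)%:P); last by rewrite hornerD hornerC.
    by move=> i; rewrite coefD; apply: (@AD) => //; apply: (@APC).
  - move=> [h Ah e]; have := evfst h x y; have := evsnd h x y.
    by rewrite -e /= => -> /esym /(key _ Ah).
have [s sA] := choice A_total.
have sB : zmod_morphism s.
  by move=> x y; apply: (Afst (x - y)) => //; apply: (AB (x, s x) (y, s y)).
have sM : monoid_morphism s.
  split; first exact: (Afst 1).
  by move=> x y; apply: (Afst (x * y)) => //; apply: (AM (x, s x) (y, s y)).
pose s' : {rmorphism K -> K} :=
  HB.pack s (GRing.isZmodMorphism.Build _ _ s sB)
            (GRing.isMonoidMorphism.Build _ _ s sM).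
by exists s' => a; apply: (Afst (j a)) => //; apply: A_gr.
Qed.

(** * Trace-dual bases and Hilbert 90 *)

Section Galois.
Variables (k : fieldType) (L : splittingFieldType k).
Implicit Types g h : gal_of {:L}.

Lemma mem_gal1 g : g \in 'Gal({:L} / 1)%g.
Proof.
rewrite gal_kHom ?sub1v //; apply/kAHomP => x /vlineP[a ->].
by rewrite linearZ /= rmorph1.
Qed.

(** Products of automorphisms compose from left to right, which is why every cocycle identity below
    has [h * g] on the left and [map_mx g] applied to the matrix of [h]. *)
Lemma galMv g h (a : L) : (g * h)%g a = h (g a).
Proof. by rewrite galM ?memvf. Qed.

Lemma map_galM m n g h (M : 'M[L]_(m, n)) :
  map_mx (g * h)%g M = map_mx h (map_mx g M).
Proof. by apply/matrixP=> i l; rewrite !mxE galMv. Qed.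

Lemma map_gal1 m n (M : 'M[L]_(m, n)) : map_mx (1%g : gal_of {:L}) M = M.
Proof. by apply/matrixP=> i l; rewrite !mxE gal_id. Qed.

Lemma gal_alg g (a : k) : g a%:A = a%:A.
Proof. by rewrite linearZ /= rmorph1. Qed.

Lemma alg_inj : injective (fun a : k => a%:A : L).
Proof.
move=> a b /eqP; rewrite -subr_eq0 -scalerBl scaler_eq0 oner_eq0 orbF subr_eq0.
by move/eqP.
Qed.

Lemma galois_fixedP (x : L) : galois 1 {:L} ->
  (forall g, g x = x) -> exists a : k, x = a%:A.
Proof.
move=> /galois_fixedField gal fx; apply/vlineP.
by rewrite -[1%VS]/(1%AS : {vspace L}) -gal; apply/fixedFieldP; rewrite ?memvf.
Qed.

(* The dual basis of a k-basis of L with respect to the trace form. *)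
Lemma gal_dual_basis : exists N (m e : 'I_N -> L),
  forall g, \sum_i m i * g (e i) = (g == 1%g)%:R.
Proof.
pose N := \dim {:L}; pose b := vbasis {:L}.
pose gT : finType := gal_of {:L}; pose gl := @enum_val gT predT.
pose M : 'M[L]_(#|gT|, N) := \matrix_(a, i) gl a b`_i.
(* Dedekind's independence of automorphisms. The column at [1] of a right inverse of [M] then
   supplies the weights. *)
have : row_free M.
  have free (c : 'rV[L]_(#|gT|)) : c *m M = 0 -> c = 0.
    move=> cM; have h0 : forall x, x \in {:L}%VS ->
        \sum_(g | predT g) c 0 (enum_rank g) * g x = 0.
      move=> x _; rewrite [x](coord_vbasis (memvf x)).
      under eq_bigr do rewrite linear_sum big_distrr /=.
      rewrite exchange_big big1 //= => i _.
      under eq_bigr do rewrite linearZ /= -scalerAr.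
      rewrite -scaler_sumr; have /rowP/(_ i) := cM; rewrite !mxE => e0.
      rewrite (reindex gl) /=; last exact/onW_bij/enum_val_bij.
      rewrite -[X in _ *: X]/(\sum_a _) -[RHS](scaler0 _ (coord b i x)).
      congr (_ *: _); apply: etrans e0; apply: eq_bigr => a _.
      by rewrite mxE /gl enum_valK.
    have z0 := gal_independent h0.
    by apply/rowP => a; rewrite mxE -(z0 (gl a)) // /gl enum_valK.
  rewrite -kermx_eq0; apply/eqP/row_matrixP => i; rewrite row0; apply: free.
  by rewrite -row_mul mulmx_ker row0.
case/row_freeP => B MB; exists N, (fun i => B i (enum_rank 1%g)), (fun i => b`_i).
move=> g; have /matrixP/(_ (enum_rank g) (enum_rank 1%g)) := MB.
rewrite !mxE (inj_eq enum_rank_inj) => <-; apply: eq_bigr => i _.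
by rewrite mxE /gl enum_rankK mulrC.
Qed.

Lemma galois_trace : galois 1 {:L} ->
  exists tr : L -> k, forall x, (tr x)%:A = \sum_(g : gal_of {:L}) g x.
Proof.
move=> gal; have H x : exists a, a%:A = \sum_(g : gal_of {:L}) g x.
  have [|a ea] := @galois_fixedP (\sum_(g : gal_of {:L}) g x) gal; last by exists a.
  move=> h; rewrite linear_sum /= [RHS](reindex_inj (mulIg h)) /=.
  by apply: eq_bigr => g _; rewrite galMv.
by have [tr trE] := choice H; exists tr.
Qed.

(** The twisted averages [b v] are fixed vectors, and the dual basis writes every [v] as an
    L-combination of them, so they span; [B] collects n independent ones as columns. *)
Lemma Hilbert90_mx n (A : gal_of {:L} -> 'M[L]_n) :
  (forall g, A g \in unitmx) ->
  (forall g h, A (h * g)%g = A g *m map_mx g (A h)) ->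
  exists2 B, B \in unitmx & forall g, A g *m map_mx g B = B.
Proof.
move=> uA cA; have A1 : A 1%g = 1%:M.
  have := cA 1%g 1%g; rewrite mulg1 map_gal1 => /(congr1 (mulmx (invmx (A 1%g)))).
  by rewrite mulKmx // mulVmx.
have [N [m [e me]]] := gal_dual_basis.
pose b (v : 'cV[L]_n) := \sum_(g : gal_of {:L}) A g *m map_mx g v.
have bfix v h : A h *m map_mx h (b v) = b v.
  rewrite /b raddf_sum mulmx_sumr [RHS](reindex_inj (mulIg h)) /=.
  by apply: eq_bigr => g _; rewrite map_mxM cA map_galM mulmxA.
have bE v : v = \sum_i m i *: b (e i *: v).
  rewrite /b; under eq_bigr do rewrite scaler_sumr.
  rewrite exchange_big /= (bigD1 1%g) //= [X in _ + X]big1 => [|g g1].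
    under eq_bigr do rewrite map_mxZ -scalemxAr scalerA.
    by rewrite -scaler_suml me eqxx scale1r addr0 A1 mul1mx map_gal1.
  under eq_bigr do rewrite map_mxZ -scalemxAr scalerA.
  by rewrite -scaler_suml me (negPf g1) scale0r.
pose T : finType := ('I_N * 'I_n)%type; pose ev := @enum_val T predT.
pose v_ (t : T) : 'cV[L]_n := b (e t.1 *: delta_mx t.2 0).
pose M : 'M[L]_(#|T|, n) := \matrix_(p, i) v_ (ev p) i 0.
have full : row_full M.
  apply/row_fullP; exists (\matrix_(a, p) (m (ev p).1 * ((ev p).2 == a)%:R)).
  apply/matrixP => a c; rewrite !mxE.
  have -> : (a == c)%:R = (delta_mx a 0 : 'cV[L]_n) c 0.
    by rewrite mxE eqxx andbT eq_sym.
  rewrite [in RHS](bE (delta_mx a 0)) summxE.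
  rewrite (reindex (@enum_rank T)) /=; last exact/onW_bij/enum_rank_bij.
  rewrite (eq_bigr (fun t : T => m t.1 * (t.2 == a)%:R * v_ t c 0)); last first.
    by move=> t _; rewrite !mxE /ev enum_rankK.
  rewrite -(pair_bigA _ (fun i l => m i * (l == a)%:R * v_ (i, l) c 0)) /=.
  apply: eq_bigr => i _; rewrite (bigD1 a) //= eqxx mulr1 big1 ?addr0 ?mxE //.
  by move=> l /negPf ->; rewrite mulr0 mul0r.
exists (rowsub (fullrankfun full) M)^T.
  by rewrite unitmx_tr -row_full_unit; apply: fullrowsub_full.
move=> g; apply/matrixP => i l; pose p := fullrankfun full l.
have /colP/(_ i) := bfix (e (ev p).1 *: delta_mx (ev p).2 0) g.
rewrite !mxE => h.
transitivity (v_ (ev p) i 0); last by [].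
rewrite -[RHS]h; apply: eq_bigr => q _; by rewrite !mxE.
Qed.

End Galois.

(** Cayley-Hamilton divided by [x], checked entrywise so that singular [x] are covered. Entries are
    turned into values of a function on [nat] so that the indices of minors compute. *)
Lemma adj_mx3 (R : comNzRingType) (x : 'M[R]_3) :
  \adj x = x *m x - \tr x *: x + (\tr (\adj x))%:M.
Proof.
have [f E] : exists f : nat -> nat -> R, forall i j : 'I_3, x i j = f i j.
  by exists (fun a b => x (inord a) (inord b)) => i j; rewrite !inord_val.
have det2 (M : 'M[R]_2) : \det M = M 0 0 * M 1 1 - M 0 1 * M 1 0.
  rewrite (expand_det_row _ 0) !big_ord_recl big_ord0 /cofactor !det_mx11 !mxE /=.
  have -> : lift 0 0 = 1 :> 'I_2 by apply: val_inj.
  have -> : lift 1 0 = 0 :> 'I_2 by apply: val_inj.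
  by rewrite /bump /=; ring.
pose s (n : nat) := bump n 0; pose t (n : nat) := bump n 1.
have adjE i j : (\adj x) i j =
    (-1) ^+ (j + i) * (f (s j) (s i) * f (t j) (t i) - f (s j) (t i) * f (t j) (s i)).
  by rewrite mxE /cofactor det2 !mxE !E.
apply/matrixP => i j; rewrite adjE; set a := \adj x in adjE *.
rewrite !mxE /mxtrace !big_ord_recl !big_ord0 !adjE !E /s /t.
by case: i => [[|[|[|i]]] //= Hi]; case: j => [[|[|[|j]]] //= Hj];
  rewrite /bump /= ?mulr1n ?mulr0n; ring.
Qed.

(** [\tr (\adj x)] is the middle coefficient of the characteristic polynomial; for invertible [x] it
    is [\det x * \tr x^-1], the form in which it will be matched. *)
Lemma Cayley_Hamilton_mx3 (R : comNzRingType) (x : 'M[R]_3) :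
  x *m x *m x - \tr x *: (x *m x) + \tr (\adj x) *: x = (\det x)%:M.
Proof.
by rewrite -mul_adj_mx [in RHS]adj_mx3 mulmxDl mulmxBl mul_scalar_mx -scalemxAl.
Qed.

Lemma comm_mx_all_scalar (R : comNzRingType) n (C : 'M[R]_n.+1) :
  (forall M, C *m M = M *m C) -> C = (C 0 0)%:M.
Proof.
move=> cC; apply/matrixP => i l.
have /matrixP/(_ i 0) := cC (delta_mx l 0); rewrite !mxE.
rewrite (bigD1 l) //= big1 ?addr0; last first.
  by move=> q /negPf ql; rewrite mxE ql mulr0.
rewrite mxE !eqxx mulr1 (bigD1 0) //= big1 ?addr0; last first.
  by move=> q /negPf ql; rewrite mxE ql andbF mul0r.
by rewrite mxE eqxx andbT => ->; case: eqP => _; rewrite ?mul1r ?mul0r.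
Qed.

(** * Norm-one elements as commutators in a division algebra of 3 x 3 matrices *)

Section DivisionAlgebra.
Variables (F : fieldType) (D : 'M[F]_3 -> Prop).
Hypotheses (D1 : D 1) (DB : forall x y, D x -> D y -> D (x - y))
  (DM : forall x y, D x -> D y -> D (x * y))
  (DV : forall x, D x -> D x^-1)
  (Dtr : forall x, D x -> D (\tr x)%:M)
  (Ddet : forall x, D x -> D (\det x)%:M)
  (Dunit : forall x, D x -> x != 0 -> x \is a GRing.unit)
  (Dcent : forall x, (forall w, D w -> x * w = w * x) -> exists c, x = c%:M).

Let D0 : D 0. Proof. by rewrite -(subrr 1); apply: DB. Qed.
Let DN x : D x -> D (- x). Proof. by rewrite -sub0r; apply: DB. Qed.
Let DD x y : D x -> D y -> D (x + y).
Proof. by move=> Dx Dy; rewrite -[y]opprK; apply: DB => //; apply: DN. Qed.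

Lemma division_nilpotent x : D x -> x ^+ 3 = 0 -> x = 0.
Proof.
move=> Dx x3; apply/eqP; apply: contraT => x0.
by have := unitrX 3 (Dunit Dx x0); rewrite x3 unitr0.
Qed.

(** The common characteristic polynomial is (X - c)^3, so [y - c] is nilpotent, hence zero. This
    disposes of the degenerate case of the next lemma. *)
Lemma division_scalar_conjugate x y c : D x -> D y -> x != 0 ->
    \tr x = \tr y -> \det x = \det y -> \tr (\adj x) = \tr (\adj y) ->
    x = c%:M -> x = y.
Proof.
move=> Dx Dy x0 eT eN eC xc.
have c0 : c != 0 by apply: contraNneq x0 => c0; rewrite xc c0 raddf0.
have adjx : \adj x = (c ^+ 2)%:M.
  have := mul_adj_mx x; rewrite xc mul_mx_scalar det_scalar => e.
  by apply: (scalerI c0); rewrite e scale_scalar_mx exprS.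
have := Cayley_Hamilton_mx3 y.
rewrite -eT -eN -eC adjx xc !mxtrace_scalar det_scalar => cy.
apply/esym/eqP; rewrite -subr_eq0; apply/eqP/division_nilpotent.
  by apply: DB; rewrite // -xc.
rewrite !exprS expr0 mulr1 -!mulmxE.
rewrite !(mulmxBl, mulmxBr) !(mul_scalar_mx, mul_mx_scalar).
rewrite -?scalemxAl -?scalemxAr !mulmxA ?mul_mx_scalar; apply/eqP;
  rewrite -(subrr (c ^+ 3)%:M) -{1}cy.
move: (y *m y *m y) (y *m y) => p q.
by apply/eqP/matrixP => i l; rewrite !mxE; case: eqP => _;
  rewrite ?mulr1n ?mulr0n; ring.
Qed.

(* The intertwiner is the quotient (P(X) - P(Y)) / (X - Y), P being the common
   characteristic polynomial, with X acting on the left by x and Y on the right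
   by y. *)
Lemma division_conjugate x y : D x -> D y -> y != 0 ->
    \tr x = \tr y -> \det x = \det y -> \tr (\adj x) = \tr (\adj y) ->
    x <> y -> exists z, [/\ D z, z != 0 & x * z = z * y].
Proof.
move=> Dx Dy y0; set T := \tr y; set N := \det y; set C := \tr (\adj y).
move=> eT eN eC xy.
have cx : x * x * x = T *: (x * x) - C *: x + N%:M.
  have := Cayley_Hamilton_mx3 x; rewrite eT eN eC !mulmxE => <-.
  by rewrite [RHS]addrC addrACA subrK subrr addr0.
have cy : y * y * y = T *: (y * y) - C *: y + N%:M.
  have := Cayley_Hamilton_mx3 y; rewrite -/T -/N -/C !mulmxE => <-.
  by rewrite [RHS]addrC addrACA subrK subrr addr0.
have DT w : D w -> D (T *: w).
  by rewrite -mul_scalar_mx mulmxE; apply: DM; apply: Dtr.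
have DC w : D w -> D (C *: w).
  suff DC : D C%:M by rewrite -mul_scalar_mx mulmxE; apply: DM.
  apply: Dtr; have -> : \adj y = N%:M * y^-1.
    by rewrite -mul_adj_mx mulmxE mulrK // Dunit.
  by apply: DM; [apply: Ddet | apply: DV].
pose z w := x * x * w + x * w * y + w * y * y - T *: (x * w + w * y) + C *: w.
have Dz w : D w -> D (z w).
  move=> Dw; apply: DD; last exact: DC.
  apply: DB; first by apply: DD; [apply: DD|]; do ?apply: DM.
  by apply: DT; apply: DD; apply: DM.
have xz w : x * z w = z w * y.
  rewrite /z !(mulrDl, mulrDr, mulrBl, mulrBr, mulrN, mulNr) -!scalerAl -!scalerAr.
  rewrite !mulrDl !mulrDr !mulrA cx -(mulrA (w * y)) -(mulrA w) (mulrA y) cy.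
  rewrite !mulrDl !mulrDr !mulrN !mulNr -!scalerAl -!scalerAr !mulrA.
  have -> : N%:M * w = w * N%:M by rewrite -!mulmxE scalar_mxC.
  apply/matrixP => i l; rewrite !mxE; ring.
have [[w [Dw zw]]|nz] := pselect (exists w, D w /\ z w != 0).
  by exists (z w); split=> //; apply: Dz.
have {}nz w : D w -> z w = 0.
  by move=> Dw; apply/eqP; apply: contraT => zw; case: nz; exists w.
(* Once [z] vanishes on D, subtracting [z w * u] from [z (w * u)] leaves only commutators of [u]
   with [y] and [y * y]. If [u] does not commute with [y], this reads [x * w = w * t] with [t]
   independent of [w]; taking [w = 1] gives [t = x], so [x] is central. *)
have key w u : D w -> D u ->
    (x * w - T *: w) * (u * y - y * u) = - (w * (u * y * y - y * y * u)).
  move=> Dw Du; have z1 : z (w * u) = 0 by apply: nz; apply: DM.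
  have z2 : z w * u = 0 by rewrite nz // mul0r.
  have : z (w * u) - z w * u = 0 by rewrite z1 z2 subrr.
  rewrite /z !(mulrDl, mulrBl, mulrDr, mulrBr, mulNr) -!scalerAl !mulrDl.
  rewrite -?scalerAl !mulrA => e; apply/eqP; rewrite -subr_eq0 -{}e.
  by rewrite !mulrN !mulrA; apply/eqP/matrixP => i l; rewrite !mxE; ring.
have x0 : x != 0.
  apply/eqP => x0; have := Dunit Dy y0.
  by rewrite -[_ \is a _]/(y \in unitmx) unitmxE -/N -eN x0 det0 unitr0.
have [[u [Du cu]]|ncu] := pselect (exists u, D u /\ u * y - y * u != 0).
  have uc : u * y - y * u \is a GRing.unit.
    by apply: Dunit => //; apply: DB; apply: DM.
  have xE w : D w -> x * w - T *: w =
      - (w * (u * y * y - y * y * u)) * (u * y - y * u)^-1.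
    by move=> Dw; rewrite -key // mulrK.
  have [|c xc] := @Dcent x.
    move=> w Dw; have := xE 1 D1;
      rewrite mulr1 mul1r mulNr => /(congr1 (fun t => w * t)).
    rewrite mulrN mulrA -mulNr -xE // mulrBr -scalerAr mulr1.
    by move/eqP; rewrite (inj_eq (addIr _)) => /eqP.
  by case: xy; apply: (division_scalar_conjugate (c := c)) => //; rewrite -?xc.
(* The remaining case has [y] central. As for a central [x], it is then a scalar and forces
   [x = y]. *)
have [|c yc] := @Dcent y.
  move=> w Dw; apply/esym/eqP; rewrite -subr_eq0; apply/negPn/negP => h.
  by case: ncu; exists w.
case: xy; apply: esym.
by apply: (division_scalar_conjugate (c := c)) => //; rewrite -?yc.
Qed.

Lemma division_SL_commutator a : D a -> \det a = 1 ->
    (forall c, a <> c%:M) ->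
  exists x z, [/\ D x, D z, x != 0, z != 0 & x * z = z * x * a].
Proof.
move=> Da da nsc; have ua : a \is a GRing.unit by rewrite unitmxE da unitr1.
have [w [Dw aw]] : exists w, D w /\ a * w != w * a.
  apply: contrapT => h; have [|c] := @Dcent a; last exact: nsc.
  by move=> w Dw; apply/eqP; apply: contraT => h'; case: h; exists w.
pose v := a * w - w * a; pose b := a^-1 - 1.
have Dv : D v by apply: DB; apply: DM.
have v0 : v != 0 by rewrite subr_eq0.
have uv := Dunit Dv v0.
have Db : D b by apply: DB => //; apply: DV.
(* Used for [q] and for [a * q]: it makes the traces of [x = q * v] and [y = x * a] both zero. *)
have trv q : q * a = a * q -> \tr (q * v) = 0.
  move=> qa; rewrite mulrBr !mulrA qa raddfB /=.
  by rewrite [\tr (q * w * a)](mxtrace_mulC (q * w)) mulmxE mulrA subrr.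
suff [q [Dq q0 qa qb]] : exists q, [/\ D q, q != 0, q * a = a * q
                                  & \tr (v^-1 * q^-1 * b) = 0].
  have uq := Dunit Dq q0; pose x := q * v; pose y := x * a.
  have Dx : D x by apply: DM.
  have Dy : D y by apply: DM.
  have ux : x \is a GRing.unit by rewrite unitrMr.
  have uy : y \is a GRing.unit by rewrite unitrMr.
  have x0 : x != 0 by apply: contraTneq ux => ->; rewrite unitr0.
  have y0 : y != 0 by apply: contraTneq uy => ->; rewrite unitr0.
  have dxy : \det x = \det y by rewrite [RHS](det_mulmx x a) da mulr1.
  have adjE t : t \is a GRing.unit -> \adj t = \det t *: t^-1.
    move=> ut; rewrite -mul_scalar_mx -mul_adj_mx !mulmxE mulrK //.
  have [|||z [Dz z0 xz]] := @division_conjugate x y Dx Dy y0 _ dxy.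
  - rewrite [RHS](mxtrace_mulC x a) mulmxE /x mulrA !trv //.
    by rewrite -mulrA qa.
  - rewrite !adjE // !mxtraceZ dxy; congr (_ * _); apply/esym/eqP.
    rewrite -subr_eq0 -raddfB /= /y invrM // -[X in _ - X]mul1r -mulrBl -/b.
    by rewrite [\tr _](mxtrace_mulC b) mulmxE /x invrM // qb.
  - move=> /eqP; rewrite /y -{1}[x]mulr1 (inj_eq (mulrI ux)) => /eqP a1.
    by apply: (nsc 1); rewrite -a1.
  by exists x, z; split=> //; rewrite xz mulrA.
(* For [q^-1 = r - a] the condition is [r * \tr (v^-1 * b) = \tr (v^-1 * a * b)]. If the factor of
   [r] vanishes, [q = 1] already works; otherwise [r] is the quotient, and [r - a] is nonzero
   because [a] is not scalar. *)
have [t0|t0] := eqVneq (\tr (v^-1 * b)) 0.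
  by exists 1; split=> //; rewrite ?oner_neq0 ?mulr1 ?mul1r // invr1 mulr1.
pose r := \tr (v^-1 * a * b) / \tr (v^-1 * b).
have Dr : D r%:M.
  rewrite /r scalar_mxM mulmxE; apply: DM.
    by apply: Dtr; apply: DM => //; apply: DM => //; apply: DV.
  have D' : D (\tr (v^-1 * b))%:M by apply: Dtr; apply: DM => //; apply: DV.
  have := DV D'; congr D; apply: (@mulrI _ (\tr (v^-1 * b))%:M).
    by apply: Dunit => //; rewrite -scalemx1 scaler_eq0 negb_or t0 matrix_nonzero1.
  rewrite divrr; last by apply: Dunit => //;
    rewrite -scalemx1 scaler_eq0 negb_or t0 matrix_nonzero1.
  by rewrite -mulmxE -scalar_mxM divff.
have ra : r%:M - a != 0 by rewrite subr_eq0; apply/eqP => h; exact: (nsc r).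
have ura : r%:M - a \is a GRing.unit by apply: Dunit => //; apply: DB.
exists (r%:M - a)^-1; split.
- by apply: DV; apply: DB.
- by rewrite invr_eq0 //.
- have c : (r%:M - a) * a = a * (r%:M - a).
    by rewrite mulrBl mulrBr -!mulmxE scalar_mxC.
  by apply: (mulrI ura); rewrite mulVKr // mulrA c mulrK.
- rewrite invrK (mulrBr v^-1) mulrBl raddfB /= -!mulmxE mul_mx_scalar !mulmxE.
  by rewrite -scalerAl mxtraceZ /r mulfVK // subrr.
Qed.

End DivisionAlgebra.

(** * The algebra D of a projective cocycle *)

Section Twisted.
Variables (k : fieldType) (L : splittingFieldType k).
Implicit Types g h : gal_of {:L}.
Variable A : gal_of {:L} -> 'M[L]_3.
Hypothesis uA : forall g, A g \in unitmx.
Hypothesis cA : forall g h, exists c, A (h * g)%g = c *: (A g *m map_mx g (A h)).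

(* The central simple k-algebra attached to the projective cocycle A. *)
Definition twisted (M : 'M[L]_3) : Prop :=
  forall g, A g *m map_mx g M = M *m A g.

Lemma twisted_conj M g : twisted M -> map_mx g M = invmx (A g) *m M *m A g.
Proof. by move=> tM; rewrite -mulmxA -tM mulKmx. Qed.

Lemma twisted1 : twisted 1.
Proof. by move=> g; rewrite map_mx1 mulmx1 mul1mx. Qed.

Lemma twistedB M N : twisted M -> twisted N -> twisted (M - N).
Proof. by move=> tM tN g; rewrite map_mxB mulmxBr mulmxBl tM tN. Qed.

Lemma twistedM M N : twisted M -> twisted N -> twisted (M * N).
Proof.
by move=> tM tN g; rewrite -mulmxE map_mxM mulmxA tM -[RHS]mulmxA -tN mulmxA.
Qed.

Lemma twistedV M : twisted M -> twisted M^-1.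
Proof.
move=> tM g; have [uM|nM] := boolP (M \in unitmx); last by rewrite invr_out.
rewrite -[M^-1]/(invmx M) map_invmx.
have ugM : map_mx g M \in unitmx by rewrite map_unitmx.
rewrite -[LHS](mulKmx uM) [M *m _]mulmxA -tM -mulmxA (mulmxA (A g)).
by rewrite -(mulmxA (A g)) mulmxV // mulmx1.
Qed.

Lemma twisted_alg (a : k) : twisted (a%:A)%:M.
Proof. by move=> g; rewrite map_scalar_mx /= gal_alg scalar_mxC. Qed.

Lemma twisted_tr M : galois 1 {:L} -> twisted M -> exists a : k, \tr M = a%:A.
Proof.
move=> galL tM; apply: galois_fixedP => // g; rewrite -trace_map_mx twisted_conj //.
by rewrite mxtrace_mulC mulmxA mulmxV // mul1mx.
Qed.

Lemma twisted_det M : galois 1 {:L} -> twisted M -> exists a : k, \det M = a%:A.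
Proof.
move=> galL tM; apply: galois_fixedP => // g; rewrite -det_map_mx twisted_conj //.
by rewrite !det_mulmx mulrAC -det_mulmx mulVmx // det1 mul1r.
Qed.

(** A projective cocycle is normalised at [1] only up to a scalar; this suffices because [A 1%g]
    acts by conjugation. *)
Lemma twisted_scalar1 : exists2 c, c != 0 & A 1%g = c%:M.
Proof.
have [c] := cA 1%g 1%g; rewrite mulg1 map_gal1 => e.
have cA1 : 1%:M = c *: A 1%g.
  rewrite -[in LHS](mulmxV (uA 1%g)) {1}e -scalemxAl -mulmxA mulmxV //.
  by rewrite mulmx1.
have c0 : c != 0.
  by apply/eqP => c0; move/eqP: cA1;
    rewrite c0 scale0r (negPf (matrix_nonzero1 _ _)).
exists c^-1; rewrite ?invr_eq0 //.
by rewrite -scalemx1 cA1 scalerA mulVf // scale1r.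
Qed.

(** Under conjugation the scalars of the projective cocycle cancel, so M |-> A_g g(M) A_g^-1 is a
    genuine group action and its sums over the group are invariant. *)
Lemma twisted_avg M :
  twisted (\sum_(g : gal_of {:L}) A g *m map_mx g M *m invmx (A g)).
Proof.
move=> h; rewrite raddf_sum mulmx_sumr mulmx_suml [RHS](reindex_inj (mulIg h)) /=.
apply: eq_bigr => g _; rewrite !map_mxM map_galM map_invmx.
have [c e] := cA h g.
have c0 : c != 0.
  apply/eqP => c0; have := uA (g * h)%g.
  by rewrite e c0 scale0r unitmxE det0 unitr0.
have ugA : map_mx h (A g) \in unitmx by rewrite map_unitmx.
have key : invmx (A (g * h)%g) *m A h = c^-1 *: invmx (map_mx h (A g)).
  apply: (can_inj (mulKmx (uA (g * h)%g))); rewrite mulKVmx // e -scalemxAl.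
  by rewrite -scalemxAr scalerA divff // scale1r mulmxK.
rewrite -[RHS]mulmxA key e -!scalemxAl -!scalemxAr scalerA mulfV // scale1r.
by rewrite !mulmxA.
Qed.

(** D spans all matrices over L: the dual weights isolate, in the averages of the multiples
    [e i *: M], the term of [1], which is [M]. Commuting with D is therefore commuting with every
    matrix. *)
Lemma twisted_span M : exists N (m : 'I_N -> L) (d : 'I_N -> 'M[L]_3),
  (forall i, twisted (d i)) /\ M = \sum_i m i *: d i.
Proof.
have [N [m [e me]]] := gal_dual_basis L.
exists N, m, (fun i => \sum_(g : gal_of {:L})
  A g *m map_mx g (e i *: M) *m invmx (A g)); split=> [i|].
  exact: twisted_avg.
under eq_bigr do rewrite scaler_sumr.
rewrite exchange_big /= (bigD1 1%g) //= [X in _ + X]big1 => [|g g1].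
  under eq_bigr do rewrite map_mxZ -scalemxAr -scalemxAl scalerA.
  rewrite -scaler_suml me eqxx scale1r addr0 map_gal1.
  have [c c0 e1] := twisted_scalar1.
  by rewrite e1 -scalar_mxC -e1 mulmxK.
under eq_bigr do rewrite map_mxZ -scalemxAr -scalemxAl scalerA.
by rewrite -scaler_suml me (negPf g1) scale0r.
Qed.

Lemma twisted_commutant x :
  (forall w, twisted w -> x * w = w * x) -> exists c, x = c%:M.
Proof.
move=> cx; exists (x 0 0); apply: comm_mx_all_scalar => M.
have [N [m [d [td ->]]]] := twisted_span M.
rewrite mulmx_sumr mulmx_suml; apply: eq_bigr => i _.
by rewrite -scalemxAr -scalemxAl; congr (_ *: _); apply: cx.
Qed.

(* The kernel or the image of d is a Galois-stable line. *)
Lemma twisted_singular d : twisted d -> d != 0 -> d \notin unitmx ->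
  exists B (c : gal_of {:L} -> L), B \in unitmx /\
    forall g, c g != 0 /\ A g *m map_mx g B = c g *: B.
Proof.
move=> td d0 nd.
(* Lines are encoded as row spaces, hence the transposes. The stable line is the image of [d] in
   rank one and its kernel in rank two. *)
have [W rW stW] : exists2 W : 'M[L]_3, \rank W = 1%N &
    forall (v : 'cV[L]_3) g, (v^T <= W)%MS -> ((A g *m map_mx g v)^T <= W)%MS.
  have r3 : (\rank d < 3)%N.
    by rewrite ltn_neqAle rank_leq_row andbT -[_ == _]/(row_free d) row_free_unit.
  have r0 : (0 < \rank d)%N by rewrite lt0n mxrank_eq0.
  have [r1|r2] : \rank d = 1%N \/ \rank d = 2%N by lia.
    exists d^T; first by rewrite mxrank_tr.
    move=> v g /submxP[w vw].
    have -> : v = d *m w^T by rewrite -[v]trmxK vw trmx_mul !trmxK.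
    by rewrite map_mxM mulmxA td -mulmxA trmx_mul submxMl.
  exists (kermx d^T); first by rewrite mxrank_ker mxrank_tr r2.
  move=> v g; rewrite !sub_kermx -!trmx_mul !trmx_eq0 mulmxA -td => /eqP e.
  by rewrite -mulmxA -map_mxM e map_mx0 mulmx0.
pose u := (nz_row W)^T.
have u0 : u != 0 by rewrite trmx_eq0 nz_row_eq0 -mxrank_eq0 rW.
have uW : (W <= u^T)%MS.
  have /andP[] // : (u^T == W)%MS.
  rewrite -(geq_leqif (mxrank_leqif_eq _)) ?rW ?trmxK ?nz_row_sub //.
  by rewrite lt0n mxrank_eq0 -[_ == 0]trmx_eq0.
have ex_c g : exists a, A g *m map_mx g u = a *: u.
  have /submx_trans/(_ uW) : ((A g *m map_mx g u)^T <= W)%MS.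
    by apply: stW; rewrite trmxK nz_row_sub.
  by case/sub_rVP => a /(congr1 trmx); rewrite trmxK linearZ /= trmxK; exists a.
have [c cE] := choice ex_c.
have c0 g : c g != 0.
  apply: contraNneq u0 => c0; have := cE g; rewrite c0 scale0r.
  move/(congr1 (mulmx (invmx (A g)))); rewrite mulKmx // mulmx0 => /eqP.
  by rewrite map_mx_eq0.
(* After this rescaling every [A' g] fixes [u]. The two sides of the cocycle identity differ by a
   scalar and both fix [u], so that scalar is 1 and Hilbert 90 applies to [A']. *)
pose A' g := (c g)^-1 *: A g.
have A'u g : A' g *m map_mx g u = u
  by rewrite -scalemxAl cE scalerA mulVf // scale1r.
have [g|g h|B uB BE] := @Hilbert90_mx _ _ _ A'.
- by rewrite unitmxZ ?unitfE ?invr_eq0 ?c0.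
- have [a e] := cA g h.
  have [b bE] : exists b, A' (h * g)%g = b *: (A' g *m map_mx g (A' h)).
    exists ((c (h * g)%g)^-1 * a * c g * g (c h)).
    rewrite /A' e map_mxZ -scalemxAl -scalemxAr !scalerA fmorphV; congr (_ *: _).
    suff : (c (h * g)%g)^-1 * a =
      (c (h * g)%g)^-1 * a * c g * g (c h) / c g / g (c h) by [].
    have := c0 g; have : g (c h) != 0 by rewrite fmorph_eq0 c0.
    have := c0 (h * g)%g.
    move: (c (h * g)%g) (g (c h)) (c g) => p q r p0 q0 r0.
    by field; rewrite p0 q0 r0.
  have : b *: u = 1 *: u.
    rewrite scale1r -{2}(A'u (h * g)%g) bE -scalemxAl map_galM -mulmxA -map_mxM.
    by rewrite !A'u.
  move/eqP; rewrite -subr_eq0 -scalerBl scaler_eq0 (negPf u0) orbF subr_eq0.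
  by move/eqP=> b1; rewrite bE b1 scale1r.
exists B, c; split=> // g; split=> //.
by rewrite -[in RHS](BE g) /A' -scalemxAl scalerA mulfV // scale1r.
Qed.

Lemma twisted_SL_commutator a : galois 1 {:L} ->
  (forall d, twisted d -> d != 0 -> d \in unitmx) ->
  twisted a -> \det a = 1 -> (forall c, a <> c%:M) ->
  exists x z, [/\ twisted x, twisted z, x \in unitmx, z \in unitmx
    & a = invmx x *m invmx z *m x *m z].
Proof.
move=> galL div ta da nsc.
have [||||||||x [z [tx tz x0 z0 e]]] :=
  @division_SL_commutator L twisted _ _ _ _ _ _ _ _ _ ta da nsc.
- exact: twisted1.
- exact: twistedB.
- exact: twistedM.
- exact: twistedV.
- by move=> x /(twisted_tr galL)[c ->]; apply: twisted_alg.
- by move=> x /(twisted_det galL)[c ->]; apply: twisted_alg.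
- exact: div.
- exact: twisted_commutant.
exists x, z; split=> //; try exact: div.
have ux := div _ tx x0; have uz := div _ tz z0.
by rewrite -!mulmxA [x *m z]e -!mulmxE -mulmxA !mulKmx.
Qed.

End Twisted.

(** * Factorial rings and Gauss's lemma *)

Section UniqueFactorization.
Variable R : idomainType.
Implicit Types a b p : R.

Definition divides a b := exists c, b = c * a.

(* Units count as primes. *)
Definition prime_elt p :=
  p != 0 /\ forall a b, divides p (a * b) -> divides p a \/ divides p b.

Definition prime_product a :=
  exists s : seq R, (forall p, p \in s -> prime_elt p) /\ a = \prod_(p <- s) p.

(** The factors are prime, not merely irreducible, so uniqueness comes for free and needs no
    clause. *)
Definition factorial := forall a, a != 0 -> prime_product a.

Lemma divides_mull a b c : divides a b -> divides a (c * b).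
Proof. by move=> [u ->]; exists (c * u); rewrite mulrA. Qed.

Lemma divides_mulr a b c : divides a b -> divides a (b * c).
Proof. by rewrite mulrC; apply: divides_mull. Qed.

Lemma dividesD a b c : divides a b -> divides a c -> divides a (b + c).
Proof. by move=> [u ->] [v ->]; exists (u + v); rewrite mulrDl. Qed.

Lemma divides_subr a b c : divides a c -> divides a (b + c) -> divides a b.
Proof. by move=> [u ->] [v e]; exists (v - u); rewrite mulrBl -e addrK. Qed.

Lemma prime_productM a b :
  prime_product a -> prime_product b -> prime_product (a * b).
Proof.
move=> [s [ps ->]] [t [pt ->]]; exists (s ++ t); rewrite big_cat; split=> // p.
by rewrite mem_cat => /orP[/ps|/pt].
Qed.

Lemma prime_product1 p : prime_elt p -> prime_product p.
Proof.
by move=> pp; exists [:: p]; rewrite big_seq1; split=> // q; rewrite inE => /eqP ->.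
Qed.

Lemma prime_divides_prod p (s : seq R) : prime_elt p -> ~ divides p 1 ->
  divides p (\prod_(q <- s) q) -> exists2 q, q \in s & divides p q.
Proof.
move=> [p0 pp] np; elim: s => [|q s IH]; rewrite ?big_nil ?big_cons // => /pp[h|].
  by exists q; rewrite ?mem_head.
by move=> /IH[r rs h]; exists r; rewrite // inE rs orbT.
Qed.

End UniqueFactorization.

Lemma factorial_iso (R S : idomainType) (f : {rmorphism S -> R}) (g : R -> S) :
  cancel f g -> cancel g f -> factorial R -> factorial S.
Proof.
move=> fK gK hR a a0.
have g0 : g 0 = 0 by rewrite -(rmorph0 f) fK.
have gM x y : g (x * y) = g x * g y by rewrite -[RHS]fK rmorphM !gK.
have g1 : g 1 = 1 by rewrite -(rmorph1 f) fK.
have [|s [ps e]] := hR (f a); first by rewrite -(inj_eq (can_inj gK)) fK g0.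
exists [seq g p | p <- s]; split; last first.
  rewrite -[LHS]fK e; elim: s {ps e} => [|p s IH] /=.
    by rewrite !big_nil g1.
  by rewrite !big_cons gM IH.
move=> _ /mapP[p /ps[p0 pp] ->]; split.
  by rewrite -(inj_eq (can_inj fK)) gK rmorph0.
move=> x y [c e']; have [|[d h]|[d h]] := pp (f x) (f y).
- by exists (f c); rewrite -rmorphM e' rmorphM gK.
- by left; exists (g d); rewrite -[x]fK h gM.
- by right; exists (g d); rewrite -[y]fK h gM.
Qed.

Section Gauss.
Variable R : idomainType.
Implicit Types (p c : R) (f g h : {poly R}).

Lemma dividesC p f :
  divides p%:P f <-> forall i, divides p f`_i.
Proof.
split=> [[g ->] i|h]; first by exists g`_i; rewrite coefMC.
have [c cE] := choice h; exists (\poly_(i < size f) c i).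
apply/polyP => i; rewrite coefMC coef_poly; case: ltnP => [_|hi] //.
by rewrite nth_default // mul0r.
Qed.

Lemma dividesC_mulX p f : divides p%:P (f * 'X) <-> divides p%:P f.
Proof.
split=> [/dividesC h|]; last exact: divides_mulr.
by apply/dividesC => i; have := h i.+1; rewrite coefMX.
Qed.

Lemma prime_polyC p : prime_elt p -> prime_elt p%:P.
Proof.
move=> [p0 pp]; split; first by rewrite polyC_eq0.
have d0 : divides p%:P 0 by exists 0; rewrite mul0r.
have dC c : divides p c -> divides p%:P c%:P by move=> [d ->]; exists d%:P;
  rewrite polyCM.
elim/poly_ind => [|f c IHf] g; first by left.
elim/poly_ind: g => [|g d IHg]; first by right.
move=> h; have : divides p (c * d).
  move/dividesC/(_ 0): h; rewrite coef0M !coefD !coefMX !coefC !eqxx /=.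
  by rewrite !add0r.
move=> /pp[pc|pd].
  have : divides p%:P (f * (g * 'X + d%:P)).
    apply/dividesC_mulX; rewrite mulrAC.
    apply: (@divides_subr _ _ _ (c%:P * (g * 'X + d%:P))); last by rewrite -mulrDl.
    by apply: divides_mulr; apply: dC.
  move=> /IHf[pf|]; last by right.
  by left; apply: dividesD; [apply/dividesC_mulX|apply: dC].
have : divides p%:P ((f * 'X + c%:P) * g).
  apply/dividesC_mulX; rewrite -mulrA.
  apply: (@divides_subr _ _ _ ((f * 'X + c%:P) * d%:P)); last by rewrite -mulrDr.
  by apply: divides_mull; apply: dC.
move=> /IHg[|pg]; first by left.
by right; apply: dividesD; [apply/dividesC_mulX|apply: dC].
Qed.

Hypothesis factR : factorial R.

Definition primitive f := forall p, prime_elt p -> divides p%:P f -> divides p 1.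

(** Primes are stripped off [f] one at a time; the number of prime factors of the leading
    coefficient bounds the process. *)
Lemma factor_content f : f != 0 ->
  exists c f0, [/\ f = c%:P * f0, prime_product c%:P & primitive f0].
Proof.
move=> f0; have [|s [ps]] := factR (a := lead_coef f); first
  by rewrite lead_coef_eq0.
have [n] := ubnP (size s); elim: n => // n IH in s f f0 ps *; rewrite ltnS => sn e.
have [[p [pin [g gE]]]|np] := pselect (exists p, p \in s /\ divides p%:P f).
  have [p0 _] := ps _ pin.
  have g0 : g != 0 by apply: contraNneq f0 => g0; rewrite gE g0 mul0r.
  have [|||c [h [hE hc hp]]] := IH (rem p s) g g0.
  - by move=> q /mem_rem /ps.
  - by rewrite size_rem // (leq_trans _ sn) // prednK // -has_predT; apply/hasP;
    exists p.
  - apply: (mulIf p0); move: e; rewrite gE lead_coefM lead_coefC => ->.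
    by rewrite (perm_big _ (perm_to_rem pin)) big_cons mulrC.
  exists (p * c), h; split=> //.
    by rewrite gE hE polyCM mulrAC mulrC mulrA [_ * p%:P]mulrC -!mulrA (mulrC h).
  rewrite polyCM; apply: prime_productM => //; apply: prime_product1.
  by apply: prime_polyC; apply: ps.
exists 1, f; split; rewrite ?polyC1 ?mul1r //.
  by exists [::]; rewrite big_nil.
(* A non-unit prime [q] dividing [f] divides the leading coefficient, hence some [p] in [s]; the two
   are associates, so [p] would divide [f] as well. *)
move=> q pq qf; apply: contrapT => nq.
have /(prime_divides_prod pq nq)[p pin [u pu]] : divides q (\prod_(p <- s) p).
  by rewrite -e; move/dividesC: qf; apply.
have [p0 pp] := ps p pin; case: (pp u q).
- by exists 1; rewrite mul1r.
- move=> [v uv]; apply: nq; exists v; move: pu; rewrite uv => /eqP.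
  by rewrite mulrAC -{1}[p]mul1r (inj_eq (mulIf p0)) => /eqP.
- move=> [v qv]; apply: np; exists p; split=> //.
  move: qf => [g ->].
  have vu : v * u = 1.
    move: pu; rewrite qv mulrA -{1}[p]mul1r => /eqP.
    by rewrite (inj_eq (mulIf p0)) mulrC => /eqP.
  by exists (g * v%:P); rewrite qv polyCM mulrA.
Qed.

(** Clears a denominator: each prime of the constant stays prime in the polynomial ring, so it can
    be cancelled from [g] or from [h] without changing degrees. *)
Lemma factor_scaled (s : seq R) f g h : (forall p, p \in s -> prime_elt p) ->
    (\prod_(p <- s) p)%:P * f = g * h ->
  exists g' h', [/\ f = g' * h', size g' = size g & size h' = size h].
Proof.
elim: s f g h => [|p s IH] f g h ps.
  by rewrite big_nil polyC1 mul1r => ->; exists g, h.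
have [p0 pp] := prime_polyC (ps p (mem_head _ _)).
have ps' q : q \in s -> prime_elt q by move=> qs; apply: ps; rewrite inE qs orbT.
rewrite big_cons polyCM -mulrA => e.
have [|[u uE]|[u uE]] := pp g h.
- by exists ((\prod_(p <- s) p)%:P * f); rewrite -e mulrC.
- have [|g' [h' [fE sg sh]]] := IH f u h ps'.
    by apply: (mulfI p0); rewrite e uE mulrCA mulrA.
  exists g', h'; split=> //; rewrite ?sg ?sh uE mulrC mul_polyC size_scale //.
  by rewrite -polyC_eq0.
- have [|g' [h' [fE sg sh]]] := IH f g u ps'.
    by apply: (mulfI p0); rewrite e uE; ring.
  exists g', h'; split=> //; rewrite ?sg ?sh uE mulrC mul_polyC size_scale //.
  by rewrite -polyC_eq0.
Qed.

(** Same cancellation, but a primitive [f] absorbs only units, so all other primes come out of the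
    quotient [q]. *)
Lemma divides_scaled (s : seq R) f g q : (forall p, p \in s -> prime_elt p) ->
  primitive f -> (\prod_(p <- s) p)%:P * g = q * f -> divides f g.
Proof.
move=> ps pf; elim: s q ps => [|p s IH] q ps.
  by rewrite big_nil polyC1 mul1r => ->; exists q.
have pp := ps p (mem_head _ _); have [p0 ppq] := prime_polyC pp.
have ps' r : r \in s -> prime_elt r by move=> rs; apply: ps; rewrite inE rs orbT.
rewrite big_cons polyCM -mulrA => e.
suff [u uE] : divides p%:P q.
  by apply: (IH u) => //; apply: (mulfI p0); rewrite e uE; ring.
case: (ppq q f) => //; first by exists ((\prod_(p <- s) p)%:P * g);
  rewrite -e mulrC.
move=> /(pf _ pp)[v v1]; exists (q * v%:P).
by rewrite -mulrA -polyCM -v1 polyC1 mulr1.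
Qed.

(* Pseudo-divisibility over R, as in polydiv, is divisibility over the fraction
   field. *)
Theorem factorial_poly : factorial {poly R}.
Proof.
move=> f; have [n] := ubnP (size f); elim: n f => // n IH f; rewrite ltnS => fn f0.
have [c [g [fE pc pg]]] := factor_content f0.
rewrite fE; apply: prime_productM => //.
have c0 : c != 0 by apply: contraNneq f0 => c0; rewrite fE c0 polyC0 mul0r.
have g0 : g != 0 by apply: contraNneq f0 => g0; rewrite fE g0 mulr0.
have sg : size g = size f by rewrite fE mul_polyC size_scale.
have [s1|s1] := leqP (size g) 1.
  have [a ga] : exists a, g = a%:P by exists g`_0; apply: size1_polyC.
  have [|s [ps e]] := factR (a := a).
    by apply: contraNneq g0 => a0; rewrite ga a0.
  rewrite ga e rmorph_prod /=; elim: s ps {e} => [|p s IHs] ps.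
    by rewrite big_nil; exists [::]; rewrite big_nil.
  rewrite big_cons; apply: prime_productM.
    by apply: prime_product1; apply: prime_polyC; apply: ps; rewrite mem_head.
  by apply: IHs => q qs; apply: ps; rewrite inE qs orbT.
(* Either [g] splits over the fraction field, and the denominator [a] is cleared to use induction,
   or [g] is irreducible there and will be shown prime. *)
have [[a [u [v [a0 e su sv]]]]|irr] := pselect (exists a u v,
    [/\ a != 0, a%:P * g = u * v, (size u < size g)%N & (size v < size g)%N]).
  have [s [ps ae]] := factR a0; rewrite ae in e.
  have [u' [v' [gE su' sv']]] := factor_scaled ps e.
  have u'0 : u' != 0 by apply: contraNneq g0 => z; rewrite gE z mul0r.
  have v'0 : v' != 0 by apply: contraNneq g0 => z; rewrite gE z mulr0.
  rewrite gE; apply: prime_productM; apply: IH => //.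
    by rewrite su'; apply: leq_trans fn; rewrite -sg.
  by rewrite sv'; apply: leq_trans fn; rewrite -sg.
apply: prime_product1; split=> // a b [q qE].
have lift h : (g %| h)%R -> divides g h.
  move=> /Pdiv.Idomain.dvdpP[[d r] /= d0 e].
  have [s [ps de]] := factR d0; apply: (@divides_scaled s _ _ r) => //.
  by rewrite -de mul_polyC.
have gab : (g %| a * b)%R by rewrite qE dvdp_mull.
have [cop|ncop] := boolP (coprimep g a).
  by right; apply: lift; rewrite -(Gauss_dvdpr _ cop).
(* The gcd of [g] and [a] is nonconstant and divides the irreducible [g], so it has the degree of
   [g] and [g] divides [a]. *)
left; apply: lift.
have dg : (gcdp g a %| g)%R by apply: dvdp_gcdl.
have d0 : gcdp g a != 0 by rewrite gcdp_eq0 (negPf g0).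
have d1 : (1 < size (gcdp g a))%N.
  by move: ncop; rewrite /coprimep; have := size_poly_gt0 (gcdp g a); rewrite d0;
    lia.
have sd : size (gcdp g a) = size g.
  apply/eqP; rewrite eqn_leq dvdp_leq //= leqNgt; apply/negP => lt.
  have [[d r] /= dn0 e] := Pdiv.Idomain.dvdpP _ _ dg.
  have r0 : r != 0.
    apply: contraNneq g0 => r0; move/eqP: e; rewrite r0 mul0r scale_poly_eq0.
    by rewrite (negPf dn0).
  apply: irr; exists d, r, (gcdp g a); split; rewrite ?mul_polyC //.
  have := size_mul r0 d0; rewrite -e size_scale // => ->.
  by move: d1; case: (size (gcdp g a)) => [|[|m]] //= _;
    rewrite !addnS /= -addSn leq_addr.
have : (gcdp g a %= g)%R by rewrite -dvdp_size_eqp // sd.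
by move/eqp_dvdl <-; apply: dvdp_gcdr.
Qed.

End Gauss.

Lemma mpoly_rmorph_eq n (R : comNzRingType) (S : nzRingType)
    (f g : {rmorphism {mpoly R[n]} -> S}) :
  (forall c, f c%:MP = g c%:MP) -> (forall i, f 'X_i = g 'X_i) -> f =1 g.
Proof.
move=> fgC fgX p; rewrite [p]mpolyE !rmorph_sum /=; apply: eq_bigr => m _.
rewrite -mul_mpolyC !rmorphM /= fgC; congr (_ * _).
rewrite mpolyXE_id !rmorph_prod /=; apply: eq_bigr => i _.
by rewrite !rmorphXn /= fgX.
Qed.

(** * Polynomials in several variables are factorial *)

Section Muni.
Variables (n : nat) (R : comNzRingType).

Lemma muniX_widen (i : 'I_n) : muni ('X_(widen_ord (leqnSn n) i) :
  {mpoly R[n.+1]}) = ('X_i)%:P.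
Proof.
rewrite muniE msuppX big_seq1 mcoeffX eqxx scale1r.
have -> : U_(widen_ord (leqnSn n) i)%MM ord_max = 0%N.
  by rewrite mnmE; case: eqP => // /(congr1 val) /= h; have := ltn_ord i; lia.
rewrite expr0 -[RHS]mulr1 mul_polyC; congr ('X_[_] *: _); apply/mnmP => l.
by rewrite !mnmE -val_eqE /= -val_eqE.
Qed.

Lemma muniX_max : muni ('X_ord_max : {mpoly R[n.+1]}) = 'X.
Proof.
rewrite muniE msuppX big_seq1 mcoeffX eqxx scale1r mnmE eqxx expr1.
rewrite -[RHS]scale1r; congr (_ *: _); rewrite -mpolyX0; congr ('X_[_]).
apply/mnmP => l; rewrite !mnmE; case: eqP => // /(congr1 val) /= h.
by have := ltn_ord l; rewrite -h ltnn.
Qed.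

Lemma ord_max_or_widen (i : 'I_n.+1) :
  i = ord_max \/ exists l, i = widen_ord (leqnSn n) l.
Proof.
have [lt|ge] := ltnP i n; last by left; apply: val_inj => /=; have := ltn_ord i;
  lia.
by right; exists (Ordinal lt); apply: val_inj.
Qed.

Let psi : {poly {mpoly R[n]}} -> {mpoly R[n.+1]} :=
  horner_eval 'X_ord_max \o map_poly (@mwiden n R).

Lemma muniK : cancel (@muni n R) psi.
Proof.
apply: (@mpoly_rmorph_eq _ _ _ (psi \o @muni n R) idfun) => [c|i] /=.
  by rewrite muniC /psi /= map_polyC /= mwidenC /horner_eval hornerC.
have [->|[l ->]] := ord_max_or_widen i.
  by rewrite muniX_max /psi /= map_polyX /horner_eval hornerX.
rewrite muniX_widen /psi /= map_polyC /= /horner_eval hornerC mwidenX mnmwiden1.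
by congr ('X_[U_(_)]); apply: val_inj.
Qed.

Lemma muni_mwiden (p : {mpoly R[n]}) : muni (mwiden p) = p%:P.
Proof.
apply: (@mpoly_rmorph_eq _ _ _ (@muni n R \o @mwiden n R) polyC) => [c|i] /=.
  by rewrite mwidenC muniC.
rewrite mwidenX mnmwiden1 -muniX_widen; congr (muni 'X_[U_(_)]).
Qed.

Lemma muniVK : cancel psi (@muni n R).
Proof.
move=> p; rewrite /psi /= /horner_eval -horner_map /= muniX_max -map_poly_comp.
rewrite (eq_map_poly muni_mwiden) /=; exact: comp_polyXr.
Qed.

End Muni.

Lemma mpoly0_const (R : nzRingType) (p : {mpoly R[0]}) : p = (p@_0)%:MP.
Proof.
apply/mpolyP => m; have -> : m = 0%MM by apply/mnmP => -[].
by rewrite mcoeffC eqxx mulr1.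
Qed.

Lemma factorial_mpoly (F : fieldType) n : factorial {mpoly F[n]}.
Proof.
elim: n => [|n IH]; last first.
  exact: (factorial_iso (@muniK n F) (@muniVK n F) (factorial_poly IH)).
move=> p p0; apply: prime_product1; split=> // a b _; left.
exists ((a@_0 / p@_0)%:MP); rewrite [p in X in _ * X]mpoly0_const -mpolyCM.
rewrite divfK; first exact: mpoly0_const.
by apply: contraNneq p0 => c0; rewrite [p]mpoly0_const c0.
Qed.

(** [G'] is [G] in lowest terms, obtained by removing common primes of the entries; every vector
    proportional to [G] is then a multiple of it. *)
Lemma primitive_vector (R : idomainType) m (G : 'I_m -> R) i0 :
    factorial R -> G i0 != 0 ->
  exists G' : 'I_m -> R, forall H : 'I_m -> R,
    (forall i l, H i * G l = H l * G i) -> exists c, forall i, H i = c * G' i.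
Proof.
move=> fR G0; have [s [ps]] := fR _ G0.
have [N] := ubnP (size s); elim: N => // N IH in s G G0 ps *; rewrite ltnS => sN e.
have [[p [pin pG]]|np] := pselect (exists p, p \in s /\ forall i, divides p (G i)).
  have [G1 G1E] := choice pG; have [p0 _] := ps _ pin.
  have G10 : G1 i0 != 0 by apply: contraNneq G0 => z; rewrite G1E z mul0r.
  have [|||G' hG'] := IH (rem p s) G1 G10.
  - by move=> q /mem_rem /ps.
  - by rewrite size_rem // (leq_trans _ sN) // prednK // -has_predT; apply/hasP;
    exists p.
  - apply: (mulIf p0); rewrite -G1E e (perm_big _ (perm_to_rem pin)) big_cons.
    by rewrite mulrC.
  exists G' => H hH; apply: hG' => i l; apply: (mulIf p0).
  by rewrite -!mulrA -!G1E.
exists G => H hH.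
suff [c cE] : divides (G i0) (H i0).
  exists c => i; apply: (mulIf G0); rewrite hH cE; ring.
(* From H_i0 G_i = H_i G_i0: each prime of [G i0] misses some [G i], so it must divide [H i0]. *)
have hs i : divides (\prod_(p <- s) p) (H i0 * G i).
  by exists (H i); rewrite -e -hH.
rewrite e; move: (H i0) hs => h {H hH G0 e sN IH}.
elim: s ps np h => [|p s IH] ps np h hs; first by exists h; rewrite big_nil mulr1.
have [p0 pp] := ps p (mem_head _ _).
have [i ni] : exists i, ~ divides p (G i).
  apply: contrapT => h0; apply: np; exists p; rewrite mem_head; split=> // i.
  by apply: contrapT => h1; apply: h0; exists i.
have [|[h' hE]|//] := pp h (G i).
  by have [c cE] := hs i; exists (c * \prod_(q <- s) q); rewrite cE big_cons; ring.
have [||i'|c cE] := IH _ _ h'.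
- by move=> q qs; apply: ps; rewrite inE qs orbT.
- by move=> [q [qs qG]]; apply: np; exists q; rewrite inE qs orbT.
- have [c cE] := hs i'; exists c; apply: (mulIf p0).
  by move: cE; rewrite hE big_cons => cE; rewrite mulrAC cE; ring.
by exists c; rewrite hE cE big_cons; ring.
Qed.

(** [p - 1] never vanishes, so it is constant over an algebraically closed field; then so is [p]. *)
Lemma closed_poly_eq0 (K : closedFieldType) (p : {poly K}) :
  (forall x, p.[x] = 0) -> p = 0.
Proof.
move=> p0; have [//|nz] := eqVneq p 0.
have : size (p - 1) == 1%N.
  apply: contraT => /closed_rootP[x /rootP]; rewrite !hornerE p0 sub0r => /eqP.
  by rewrite oppr_eq0 oner_eq0.
move=> /size_poly1P[c c0 e]; move: p0; have -> : p = (c + 1)%:P.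
  by rewrite polyCD -e subrK.
by move/(_ 0); rewrite hornerC => ->.
Qed.

Lemma closed_poly_const (K : closedFieldType) (p : {poly K}) :
  (forall x, p.[x] != 0) -> forall x y, p.[x] = p.[y].
Proof.
move=> nz x y; have : size p == 1%N.
  by apply: contraT => /closed_rootP[z /rootP /eqP]; rewrite (negPf (nz z)).
by move=> /size_poly1P[c _ ->]; rewrite !hornerC.
Qed.

Lemma closed_poly_monomial (K : closedFieldType) (p : {poly K}) :
  (forall x, x != 0 -> p.[x] != 0) ->
  exists m, forall x, p.[x] = p.[1] * x ^+ m.
Proof.
have [n] := ubnP (size p); elim: n p => // n IH p; rewrite ltnS => pn nz.
have p0 : p != 0.
  by apply: contraTneq (nz 1 (oner_neq0 _)) => ->; rewrite horner0 eqxx.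
have [r0|r0] := eqVneq p.[0] 0; last first.
  exists 0%N => x; rewrite expr0 mulr1; apply: closed_poly_const => y.
  by have [->|] := eqVneq y 0; last exact: nz.
have /factor_theorem[q qE] : root p 0 by apply/rootP.
rewrite subr0 in qE.
have q0 : q != 0 by apply: contraNneq p0 => q0; rewrite qE q0 mul0r.
have [||m mE] := IH q.
- by apply: leq_trans pn; rewrite qE size_mulX.
- move=> x /nz; rewrite qE hornerM hornerX mulf_eq0 negb_or => /andP[] //.
exists m.+1 => x; rewrite qE !hornerM !hornerX mulr1 mE exprS; ring.
Qed.

(** * Polynomial functions on affine space and on lines *)

Section Evaluation.
Variables (F : fieldType) (K : closedFieldType) (e : {rmorphism F -> K}).

Lemma mmap_muni n (h : 'I_n.+1 -> K) (p : {mpoly F[n.+1]}) :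
  mmap e h p = (map_poly (mmap e (fun i => h (widen_ord (leqnSn n) i))) (muni p)).[h ord_max].
Proof.
pose w := mmap e (fun i => h (widen_ord (leqnSn n) i)).
apply: (@mpoly_rmorph_eq _ _ _ (mmap e h)
  (horner_eval (h ord_max) \o map_poly w \o @muni n F)) => [c|i] /=.
  by rewrite mmapC muniC map_polyC /= /horner_eval hornerC /w mmapC.
rewrite mmapX mmap1U; have [->|[l ->]] := ord_max_or_widen i.
  by rewrite muniX_max map_polyX /horner_eval hornerX.
by rewrite muniX_widen map_polyC /= /horner_eval hornerC /w mmapX mmap1U.
Qed.

Lemma mmap_eq0 n (p : {mpoly F[n]}) : (forall h, mmap e h p = 0) -> p = 0.
Proof.
elim: n p => [|n IH] p p0.
  apply/mpolyP => m; rewrite mcoeff0; have -> : m = 0%MM by apply/mnmP => -[].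
  have := p0 (fun=> 0); rewrite [p]mpoly0_const mmapC mcoeffC eqxx mulr1 => /eqP.
  by rewrite fmorph_eq0 => /eqP.
apply: (can_inj (@muniK n F)); rewrite raddf0; apply/polyP => i; rewrite coef0.
apply: IH => h'.
suff q0 : map_poly (mmap e h') (muni p) = 0.
  by have := coef_map (mmap e h') (muni p) i; rewrite q0 coef0.
apply: closed_poly_eq0 => x.
pose h (l : 'I_n.+1) := if insub (val l) is Some l' then h' l' else x.
have hmax : h ord_max = x by rewrite /h insubF //= ltnn.
have hw l : h (widen_ord (leqnSn n) l) = h' l.
  by rewrite /h /= insubT //= => lt; congr h'; apply: val_inj.
have := p0 h; rewrite mmap_muni hmax => <-; congr (_.[x]).
by congr map_poly; apply/funext => q; congr mmap; apply/funext => l; rewrite hw.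
Qed.

(** Nothing is known at the origin, so the argument is applied to 'X_0 times [p], which vanishes
    there anyway. *)
Lemma peval_eq0 n (p : {mpoly F[n.+1]}) :
  (forall v : 'cV[K]_n.+1, v != 0 -> peval e p v = 0) -> p = 0.
Proof.
move=> p0; have : 'X_0 * p = 0.
  apply: mmap_eq0 => h; rewrite rmorphM /= mmapX mmap1U.
  have [->|h0] := eqVneq (h 0) 0; first by rewrite mul0r.
  have hE : (fun i => (\col_l h l) i 0) = h by apply/funext => i; rewrite mxE.
  have := p0 (\col_l h l); rewrite /peval hE => ->; first by rewrite mulr0.
  by apply: contraNneq h0 => /colP/(_ 0); rewrite !mxE => ->.
have X0 : 'X_0 != 0 :> {mpoly F[n.+1]}.
  apply/eqP => /(congr1 (mcoeff U_(0))); rewrite mcoeffX mcoeff0 eqxx => /eqP.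
  by rewrite oner_eq0.
by move/eqP; rewrite mulf_eq0 (negPf X0) => /eqP.
Qed.

Definition line_poly n (p : {mpoly F[n]}) (v w : 'cV[K]_n) : {poly K} :=
  mmap (polyC \o e) (fun i => (v i 0)%:P + (w i 0)%:P * 'X) p.

Lemma line_polyE n (p : {mpoly F[n]}) v w t :
  (line_poly p v w).[t] = peval e p (v + t *: w).
Proof.
apply: (@mpoly_rmorph_eq _ _ _ (horner_eval t \o
  mmap (polyC \o e) (fun i => (v i 0)%:P + (w i 0)%:P * 'X))
  (mmap e (fun i => (v + t *: w) i 0))) => [c|i] /=.
  by rewrite !mmapC /= /horner_eval hornerC.
by rewrite !mmapX !mmap1U /horner_eval !hornerE !mxE mulrC.
Qed.

(** On a line through the origin the coefficient of t is the linear part of [p]; this is how the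
    matrix of a linear map is read off. *)
Lemma line_poly_coef1 n (p : {mpoly F[n]}) v :
  (line_poly p 0 v)`_1 = \sum_i e p@_U_(i) * v i 0.
Proof.
pose c (m : 'X_{1..n}) : K := (mmap1 (fun i => (v i 0)%:P * 'X) m)`_1.
have cE m : c m = \sum_i (m == U_(i)%MM)%:R * v i 0.
  have -> : c m = ((\prod_i v i 0 ^+ m i)%:P * 'X^(mdeg m))`_1.
    rewrite /c /mmap1 mdegE -prodrXr rmorph_prod -big_split /=;
      congr ((polyseq _)`_1).
    by apply: eq_bigr => i _; rewrite exprMn rmorphXn.
  rewrite coefCM coefXn.
  have [[i ->]|nU] := pselect (exists i, m = U_(i)%MM).
    rewrite mdeg1 eqxx mulr1 (bigD1 i) //= big1 => [|l li]; last first.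
      by rewrite mnmE eq_sym (negPf li) expr0.
    rewrite mnmE eqxx expr1 mulr1 [RHS](bigD1 i) //= eqxx mul1r big1 ?addr0 // => l li.
    by rewrite eq_mnm1 eq_sym (negPf li) mul0r.
  have -> : (1 == mdeg m) = false.
    apply/negP; rewrite eq_sym => /mdeg1P[i /eqP mi]; apply: nU.
    by exists i; rewrite mi.
  rewrite mulr0 big1 // => i _; case: eqP => [mi|]; last by rewrite mul0r.
  by case: nU; exists i.
have -> : line_poly p 0 v =
  \sum_(m <- msupp p) (e p@_m)%:P * mmap1 (fun i => (v i 0)%:P * 'X) m.
  rewrite /line_poly /mmap; apply: eq_bigr => m _; congr (_ * _).
  by rewrite /mmap1; apply: eq_bigr => i _; rewrite mxE polyC0 add0r.
rewrite coef_sum; under eq_bigr do rewrite coefCM -/(c _) cE big_distrr /=.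
rewrite exchange_big /=; apply: eq_bigr => i _.
have [Ui|nUi] := boolP (U_(i)%MM \in msupp p).
  rewrite (bigD1_seq _ Ui (msupp_uniq p)) /= eqxx mul1r big1 ?addr0 // => m /negPf ->.
  by rewrite mul0r mulr0.
rewrite (memN_msupp_eq0 nUi) rmorph0 mul0r big1_seq // => m /andP[_ mp].
case: eqP => [mi|_]; last by rewrite mul0r mulr0.
by rewrite mi (negPf nUi) in mp.
Qed.

End Evaluation.

Section Points.
Variable K : fieldType.

Lemma hcoord_exists n (x : proj K n) : exists v, hcoord x v.
Proof.
exists (vpick (val x)); rewrite /hcoord memv_pick andbT vpick0.
by rewrite -dimv_eq0 (eqP (valP x)).
Qed.

Lemma hcoord_vline n (x : proj K n) v : hcoord x v -> val x = <[v]>%VS.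
Proof.
move=> /andP[v0 vx]; apply/eqP; rewrite eq_sym eqEdim -memvE vx (eqP (valP x)).
by rewrite dim_vline v0.
Qed.

Lemma hcoord_inj n (x y : proj K n) v : hcoord x v -> hcoord y v -> x = y.
Proof. by move=> xv yv; apply: val_inj;
  rewrite (hcoord_vline xv) (hcoord_vline yv). Qed.

Lemma hcoordZ n (x : proj K n) v c : c != 0 -> hcoord x v -> hcoord x (c *: v).
Proof.
by move=> c0 /andP[v0 vx]; rewrite /hcoord scaler_eq0 negb_or c0 v0 memvZ.
Qed.

Lemma proj_point n (v : 'cV[K]_n.+1) : v != 0 -> exists x : proj K n, hcoord x v.
Proof.
move=> v0; have d1 : \dim <[v]> == 1%N by rewrite dim_vline v0.
by exists (exist _ <[v]>%VS d1); rewrite /hcoord v0 memv_line.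
Qed.

Lemma P2_point (v : 'cV[K]_3) : v != 0 -> exists x : P2 K, hcoord (val x) v.
Proof.
by move=> /proj_point[x xv]; exists (SigSub (mem_set (I : P2 K x))).
Qed.

Lemma scale_minor n (u : 'cV[K]_n) a b i l :
  (a *: u) i 0 * (b *: u) l 0 = (a *: u) l 0 * (b *: u) i 0.
Proof. by rewrite !mxE; ring. Qed.

End Points.

Lemma scale_pow_id (K : closedFieldType) m m' :
  (forall t : K, t != 0 -> t ^+ m ^+ m' = t) -> m = 1%N.
Proof.
move=> h; suff : (m * m' = 1)%N by move/eqP; rewrite muln_eq1 => /andP[/eqP].
move: h; have [d dE] : exists d, d = (m * m')%N by exists (m * m')%N.
move=> h; rewrite -dE.
(* The extra factor t makes the identity t^d = t hold at t = 0 too, whatever [d] is. *)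
have p0 : 'X^(d.+1) - 'X^2 = 0 :> {poly K}.
  apply: closed_poly_eq0 => t; rewrite !hornerE.
  have [->|t0] := eqVneq t 0; first by rewrite !expr0n subrr.
  by rewrite exprS dE exprM h // -expr2 subrr.
have /eqP := congr1 (fun p : {poly K} => p`_2) p0.
rewrite coefB !coefXn coef0 eqxx subr_eq0; case: (2%N =P d.+1) => [[<-] //|_].
by rewrite eq_sym oner_eq0.
Qed.

(** * Automorphisms of the projective plane are linear *)

Section LinearAutomorphisms.
Variables (F : fieldType) (K : closedFieldType) (e : {rmorphism F -> K}).

(** All local presentations are proportional, hence multiples of one primitive vector, which
    therefore vanishes nowhere. Its homogeneity is not recorded; scaling is recovered later from its
    values. *)
Lemma P2_morphism_global (f : P2 K -> P2 K) : morphism_over e f ->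
  exists G : 'I_3 -> {mpoly F[3]}, forall (x : P2 K) v,
    hcoord (val x) v -> hcoord (val (f x)) (pevals e G v).
Proof.
move=> mf.
have [x0 x0v] : exists x : P2 K, hcoord (val x) (const_mx 1).
  apply: P2_point; apply/eqP => /colP/(_ 0); rewrite !mxE => /eqP.
  by rewrite oner_eq0.
have [d [G [_ Gx Gf]]] := mf x0.
have [i0 Gi0] : exists i, G i != 0.
  have /matrix0Pn[i [l]] := Gx _ x0v; rewrite mxE => h; exists i.
  by apply: contraNneq h => ->; rewrite /peval raddf0.
have [G' G'P] := primitive_vector (@factorial_mpoly F 3) Gi0.
exists G' => x v xv; have [d' [H [_ Hx Hf]]] := mf x.
have Hv := Hx v xv.
have [|c cE] := G'P H.
  move=> i l; apply/eqP; rewrite -subr_eq0; apply/eqP; apply: (peval_eq0 (e :=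
    e)) => w w0.
  rewrite /peval rmorphB !rmorphM /=; apply/eqP; rewrite subr_eq0; apply/eqP.
  have [y yw] := P2_point w0.
  have EG m : mmap e (fun i => w i 0) (G m) = pevals e G w m 0 by rewrite mxE.
  have EH m : mmap e (fun i => w i 0) (H m) = pevals e H w m 0 by rewrite mxE.
  rewrite !EG !EH.
  have [->|G0] := eqVneq (pevals e G w) 0; first by rewrite !mxE !mulr0.
  have [->|H0] := eqVneq (pevals e H w) 0; first by rewrite !mxE !mul0r.
  have [a _ ->] := hcoord_scale (Gf y w yw G0) (Hf y w yw H0).
  by rewrite -{2 4}[pevals e G w]scale1r scale_minor.
have HE : pevals e H v = peval e c v *: pevals e G' v.
  by apply/colP => i; rewrite !mxE cE /peval rmorphM.
have hH := Hf x v xv Hv; have := Hv; rewrite HE scaler_eq0 negb_or => /andP[c0 G0].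
rewrite -[pevals e G' v](scalerK c0) -HE; apply: hcoordZ => //.
by rewrite invr_eq0.
Qed.

Lemma independent_minor (v w : 'cV[K]_3) : v != 0 -> (forall c, w <> c *: v) ->
  exists i l, v i 0 * w l 0 - v l 0 * w i 0 != 0.
Proof.
move=> /matrix0Pn[i [z]]; rewrite ord1 => vi nw; apply: contrapT => h.
apply: (nw (w i 0 / v i 0)); apply/colP => l; rewrite mxE.
apply: (mulfI vi); rewrite mulrCA mulrA divfK //.
apply/eqP; rewrite -subr_eq0; apply: contraT => hh; case: h; exists i, l.
by rewrite [v l 0 * _]mulrC.
Qed.

Lemma exists_independent (v : 'cV[K]_3) :
  exists u : 'cV[K]_3, u != 0 /\ forall c, u <> c *: v.
Proof.
have nz i : delta_mx i 0 != 0 :> 'cV[K]_3.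
  by apply/eqP => /colP/(_ i); rewrite !mxE !eqxx => /eqP; rewrite oner_eq0.
have [[c hc]|] := pselect (exists c, delta_mx 0 0 = c *: v :> 'cV[K]_3); last first.
  by move=> h; exists (delta_mx 0 0); split=> // c hc; apply: h; exists c.
exists (delta_mx 1 0); split=> // c' hc'.
have c0 : c != 0 by apply: contraNneq (nz 0) => c0; rewrite hc c0 scale0r.
move: hc'; have -> : v = c^-1 *: delta_mx 0 0 by rewrite hc scalerK.
move=> /colP/(_ 1); rewrite !mxE /= !mulr0 => /eqP; by rewrite oner_eq0.
Qed.

Lemma P2_automorphism_linear (f f' : P2 K -> P2 K) :
    cancel f f' -> morphism_over e f -> morphism_over e f' ->
  exists2 A : 'M[F]_3, A \in unitmx & forall (x : P2 K) v,
    hcoord (val x) v -> hcoord (val (f x)) (map_mx e A *m v).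
Proof.
move=> fK /P2_morphism_global[G GE] /P2_morphism_global[H HE].
have Gnz v : v != 0 -> pevals e G v != 0.
  by move=> /P2_point[x xv]; have /andP[] := GE x v xv.
have Hnz v : v != 0 -> pevals e H v != 0.
  by move=> /P2_point[x xv]; have /andP[] := HE x v xv.
(* The ratio between H o G and the identity is a nowhere vanishing polynomial on
   each affine line that avoids the origin, hence constant. *)
have HGE v : v != 0 -> exists2 q, q != 0 & pevals e H (pevals e G v) = q *: v.
  move=> v0; have [x xv] := P2_point v0; apply: (hcoord_scale xv).
  by have := HE (f x) _ (GE x v xv); rewrite fK.
have qline v u q q' : v != 0 -> u != 0 -> (forall c, u <> c *: v) ->
    pevals e H (pevals e G v) = q *: v -> pevals e H (pevals e G u) = q' *: u ->
      q = q'.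
  move=> v0 u0 uv qv qu; have [w wE] : exists w, w = u - v by exists (u - v).
  have nw c : w <> c *: v.
    by move=> wc; apply: (uv (c + 1)); rewrite scalerDl scale1r -wc wE subrK.
  have [i [l dl]] := independent_minor v0 nw.
  set del := v i 0 * w l 0 - v l 0 * w i 0 in dl.
  pose HG m := line_poly e (H m \mPo [tuple G b | b < 3]) v w.
  have HGt m t : (HG m).[t] = pevals e H (pevals e G (v + t *: w)) m 0.
    by rewrite line_polyE peval_comp [RHS]mxE.
  (* Cramer's rule: the minor of H(G(v + t w)) against w, divided by the minor of v against w, is
     the ratio; so the ratio is a polynomial in t. *)
  pose Q := (HG i * (w l 0)%:P - HG l * (w i 0)%:P) * (del^-1)%:P.
  have tw t : v + t *: w != 0.
    apply/eqP => h; have [t0|t0] := eqVneq t 0.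
      by move: h; rewrite t0 scale0r addr0 => /eqP; rewrite (negPf v0).
    apply: (nw (- t^-1)); rewrite scaleNr; apply: (scalerI t0).
    rewrite scalerN scalerA divff // scale1r; apply/eqP.
    by rewrite -addr_eq0 addrC h.
  have Qt t : pevals e H (pevals e G (v + t *: w)) = Q.[t] *: (v + t *: w).
    have [a a0 aE] := HGE _ (tw t); rewrite aE; congr (_ *: _).
    rewrite /Q !hornerE !HGt aE !mxE /del; apply: (mulIf dl); rewrite mulfVK //.
    by rewrite /del; ring.
  have Qnz t : Q.[t] != 0.
    apply/eqP => Q0; have := Qt t; rewrite Q0 scale0r => /eqP.
    by rewrite (negPf (Hnz _ (Gnz _ (tw t)))).
  have := closed_poly_const Qnz 0 1.
  have scal a b (z : 'cV[K]_3) : z != 0 -> a *: z = b *: z -> a = b.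
    move=> z0 /eqP; rewrite -subr_eq0 -scalerBl scaler_eq0 (negPf z0) orbF subr_eq0.
    by move/eqP.
  have -> : Q.[0] = q.
    by apply: (scal _ _ v) => //; have := Qt 0; rewrite scale0r addr0 qv.
  suff -> : Q.[1] = q' by [].
  apply: (scal _ _ u) => //; have := Qt 1.
  by rewrite scale1r addrC wE subrK qu.
(* On the line through [v] a nonzero coordinate of [G0] vanishes at most at t = 0, so it is a
   monomial in t; its exponent may still depend on [v]. *)
have powE (G0 : 'I_3 -> {mpoly F[3]}) (f0 : P2 K -> P2 K) :
    (forall (x : P2 K) v, hcoord (val x) v ->
      hcoord (val (f0 x)) (pevals e G0 v)) ->
    forall v, v != 0 -> exists m, forall t, t != 0 ->
      pevals e G0 (t *: v) = t ^+ m *: pevals e G0 v.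
  move=> G0E v v0; have [x xv] := P2_point v0.
  have /andP[nz _] := G0E x v xv; have /matrix0Pn[i [z]] := nz; rewrite ord1 => nzi.
  pose r t := (line_poly e (G0 i) 0 v).[t].
  have rE t : r t = pevals e G0 (t *: v) i 0 by rewrite /r line_polyE add0r mxE.
  have sc t : t != 0 -> exists2 c, c != 0 & pevals e G0 (t *: v) =
    c *: pevals e G0 v.
    move=> t0; apply: (hcoord_scale (G0E x v xv)); apply: G0E; exact: hcoordZ.
  have [|m mE] := @closed_poly_monomial K (line_poly e (G0 i) 0 v).
    move=> t t0; rewrite -/(r t) rE; have [c c0 ->] := sc t t0.
    by rewrite [X in X != _]mxE mulf_neq0.
  exists m => t t0; have [c c0 cE] := sc t t0; rewrite cE; congr (_ *: _).
  apply: (mulIf nzi); have := mE t;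
    rewrite -/(r t) -/(r 1) !rE scale1r cE mxE => ->.
  by rewrite mulrC.
have Glin v t : v != 0 -> t != 0 -> pevals e G (t *: v) = t *: pevals e G v.
  move=> v0 t0; have [m mE] := powE G f GE v v0.
  have [m' m'E] := powE H f' HE _ (Gnz v v0).
  suff m1 : m = 1%N by rewrite mE // m1 expr1.
  (* The ratio of H o G to the identity agrees at [v] and [s *: v], each being compared with a
     vector [u] off their common line. Hence s^(m m') = s for all nonzero s. *)
  apply: (@scale_pow_id K m m') => s s0.
  have [q q0 qE] := HGE v v0.
  have sv0 : s *: v != 0 by rewrite scaler_eq0 negb_or s0.
  have [u [u0 uv]] := exists_independent v.
  have [qu _ quE] := HGE u u0.
  have [q' _ q'E] := HGE _ sv0.
  have qq : q = qu by apply: (qline v u).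
  have q'q : q' = qu.
    apply: (qline (s *: v) u) => // c hc; apply: (uv (c * s)).
    by rewrite -scalerA.
  have := q'E; rewrite mE // m'E ?expf_neq0 // qE q'q -qq !scalerA => h.
  have : (s ^+ m ^+ m' * q - q * s) *: v = 0 by rewrite scalerBl h subrr.
  move/eqP; rewrite scaler_eq0 (negPf v0) orbF mulrC -mulrBr mulf_eq0 (negPf q0).
  by rewrite subr_eq0 => /eqP.
pose A : 'M[F]_3 := \matrix_(i, l) (G i)@_U_(l).
have GA v : v != 0 -> pevals e G v = map_mx e A *m v.
  move=> v0; apply/colP => i; rewrite [RHS]mxE.
  under eq_bigr do rewrite !mxE.
  rewrite -line_poly_coef1.
  have -> : line_poly e (G i) 0 v = (pevals e G v i 0)%:P * 'X.
    have X0 : 'X != 0 :> {poly K} by rewrite polyX_eq0.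
    apply: (mulIf X0); apply/eqP; rewrite -subr_eq0; apply/eqP.
    apply: closed_poly_eq0 => t; rewrite !hornerE line_polyE add0r.
    have [->|t0] := eqVneq t 0; first by rewrite !mulr0 subrr.
    have := Glin v t v0 t0 => /colP/(_ i); rewrite [LHS]mxE [RHS]mxE => ->; ring.
  by rewrite coefCM coefX mulr1.
exists A; last first.
  by move=> x v xv; have /andP[v0 _] := xv; rewrite -GA //; apply: GE.
rewrite -(map_unitmx e) -unitmx_tr -row_free_unit -kermx_eq0.
apply/rowV0P => w /sub_kermxP wA; apply/eqP; apply: contraT => w0.
have := Gnz w^T; rewrite trmx_eq0 => /(_ w0); rewrite GA ?trmx_eq0 //.
by rewrite -[map_mx e A]trmxK -trmx_mul wA trmx0 eqxx.
Qed.

End LinearAutomorphisms.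

(** * Conjugate points and Galois descent of morphisms *)

Section CoefficientMap.
Variables (R S : nzRingType) (n : nat).

(** [c] is an arbitrary function because descent pushes coefficients through a trace form, which is
    not multiplicative. *)
Definition mpoly_push (c : R -> S) (p : {mpoly R[n]}) : {mpoly S[n]} :=
  \sum_(m <- msupp p) c p@_m *: 'X_[m].

Lemma dhomog_push c p d : p \is d.-homog -> mpoly_push c p \is d.-homog.
Proof.
move=> /dhomogP hp; rewrite /mpoly_push big_seq; apply: rpred_sum => m mp.
by apply: dhomogZ; rewrite dhomogX /=; apply/eqP/hp.
Qed.

End CoefficientMap.

Lemma peval_push (R F K : fieldType) (e : {rmorphism F -> K}) n (c : R -> F)
    (p : {mpoly R[n]}) v :
  peval e (mpoly_push c p) v =
    \sum_(m <- msupp p) e (c p@_m) * mmap1 (fun i => v i 0) m.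
Proof.
by rewrite /peval raddf_sum /=; apply: eq_bigr => m _; rewrite mmapZ mmapX.
Qed.

Definition conj_point (K : fieldType) n (s : {rmorphism K -> K}) (x y : proj K n) :=
  forall u, hcoord x u -> hcoord y (map_mx s u).

Section ConjugatePoints.
Variable K : fieldType.
Implicit Types s t : {rmorphism K -> K}.

Lemma conj_point_exists n s (x : proj K n) : exists y, conj_point s x y.
Proof.
have [v xv] := hcoord_exists x; have /andP[v0 _] := xv.
have [|y yv] := @proj_point K n (map_mx s v); first by rewrite map_mx_eq0.
exists y => u xu; have [c c0 ->] := hcoord_scale xv xu.
by rewrite map_mxZ; apply: hcoordZ; rewrite ?fmorph_eq0.
Qed.

Lemma conj_point_hcoord n s (x y : proj K n) u :
  hcoord x u -> hcoord y (map_mx s u) -> conj_point s x y.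
Proof.
move=> xu yu w xw; have [c c0 ->] := hcoord_scale xu xw.
by rewrite map_mxZ; apply: hcoordZ; rewrite ?fmorph_eq0.
Qed.

Lemma conj_point_fun n s (x y y' : proj K n) :
  conj_point s x y -> conj_point s x y' -> y = y'.
Proof.
have [v xv] := hcoord_exists x; move=> /(_ v xv) h /(_ v xv); exact: hcoord_inj.
Qed.

(** Surjectivity of [s] is not assumed: the scalar relating the two conjugates is a quotient of
    conjugate coordinates, hence itself in the image of [s]. *)
Lemma conj_point_inj n s (x x' y : proj K n) :
  conj_point s x y -> conj_point s x' y -> x = x'.
Proof.
have [v xv] := hcoord_exists x; have [w xw] := hcoord_exists x'.
move=> /(_ v xv) h /(_ w xw) h'; have [c c0] := hcoord_scale h h'.
have /andP[v0 _] := xv; have /matrix0Pn[i [z]] := v0; rewrite ord1 => vi.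
move=> wE; have cE : c = s (w i 0 / v i 0).
  have /colP/(_ i) := wE; rewrite !mxE fmorph_div => ->.
  by rewrite mulfK // fmorph_eq0.
have wv : w = (w i 0 / v i 0) *: v.
  by apply: (map_mx_inj (f := s)); rewrite map_mxZ -cE.
apply: (@hcoord_inj _ _ _ _ w) => //; rewrite wv; apply: hcoordZ => //.
by move: c0; rewrite cE fmorph_eq0.
Qed.

End ConjugatePoints.

Section Descent.
Variables (k : fieldType) (K : closedFieldType) (iota : {rmorphism k -> K}).
Variables (L : splittingFieldType k) (j : {rmorphism L -> K}).
Hypotheses (K_closure : algebraic_closure iota) (L_galois : galois 1 {:L}).
Hypothesis L_in_K : forall a : k, j a%:A = iota a.
Implicit Types (g : gal_of {:L}) (s : {rmorphism K -> K}).

Definition extends s g := forall a, s (j a) = j (g a).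

Lemma gal_extension g : exists s, extends s g.
Proof.
have [|s sE] := @extend_to_closure L K j (j \o g); last by exists s.
move=> x; have [p p0 rp] := K_closure x.
exists (map_poly (in_alg L) p); first by rewrite map_poly_eq0.
by rewrite -map_poly_comp (eq_map_poly (g := iota)).
Qed.

Lemma extends_iota s g a : extends s g -> s (iota a) = iota a.
Proof. by move=> sg; rewrite -L_in_K sg gal_alg. Qed.

Lemma peval_iota_conj n s g (p : {mpoly k[n]}) v : extends s g ->
  peval iota p (map_mx s v) = s (peval iota p v).
Proof.
move=> sg; rewrite /peval /mmap rmorph_sum; apply: eq_bigr => m _.
rewrite rmorphM /= (extends_iota _ sg); congr (_ * _).
by rewrite /mmap1 rmorph_prod; apply: eq_bigr => i _; rewrite rmorphXn mxE.
Qed.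

Lemma defined_over_conj n (X : set (proj K n)) s g x y :
  defined_over iota X -> extends s g -> conj_point s x y -> X x -> X y.
Proof.
move=> [ps hom XE] sg xy /XE Xx; apply/XE => p v pin yv.
have [u xu] := hcoord_exists x; have [d hp] := hom p pin.
have [c c0 ->] := hcoord_scale (xy u xu) yv.
by rewrite (peval_scale _ _ _ hp) (peval_iota_conj _ _ sg) Xx // rmorph0 mulr0.
Qed.

Lemma morphism_over_extension n m (X : set (proj K n)) (Y : set (proj K m))
    (f : X -> Y) : morphism_over iota f -> morphism_over j f.
Proof.
move=> mf x; have [d [G [hG Gx Gf]]] := mf x.
exists d, (fun i => mpoly_push (in_alg L) (G i)).
have E v : pevals j (fun i => mpoly_push (in_alg L) (G i)) v = pevals iota G v.
  apply/colP => i; rewrite !mxE peval_push; apply: eq_bigr => l _.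
  by rewrite -L_in_K.
split=> [i|v|y v]; rewrite ?E; [exact: dhomog_push|exact: Gx|exact: Gf].
Qed.

Definition equivariant n m (X : set (proj K n)) (Y : set (proj K m)) (f : X -> Y) :=
  forall s g, extends s g -> forall x y : X,
    conj_point s (val x) (val y) -> conj_point s (val (f x)) (val (f y)).

(* Averaging a local presentation over the Galois group, with the weights of a
   trace-dual basis so that at least one average does not vanish. *)
Lemma morphism_descent n m (X : set (proj K n)) (Y : set (proj K m)) (f : X -> Y) :
  defined_over iota X -> morphism_over j f -> equivariant f -> morphism_over iota f.
Proof.
move=> dX mf eqf x; have [d [G [hG Gx Gf]]] := mf x.
have [tr trE] := galois_trace L_galois.
have [N [mu [ep dual]]] := gal_dual_basis L.
(* Expanding the trace, [Gi q] is the combination of the Galois conjugates of [G] with coefficients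
   g(ep q). *)
pose Gi q i := mpoly_push (fun c => tr (ep q * c)) (G i).
pose Gg g v := pevals (j \o g) G v.
have GiE q v : pevals iota (Gi q) v = \sum_(g : gal_of {:L}) j (g (ep q)) *: Gg g v.
  apply/colP => i; rewrite mxE peval_push summxE.
  transitivity (\sum_(l <- msupp (G i)) \sum_(g : gal_of {:L})
      j (g (ep q)) * (j (g (G i)@_l) * mmap1 (fun b => v b 0) l)).
    apply: eq_bigr => l _; rewrite -L_in_K trE rmorph_sum big_distrl /=.
    by apply: eq_bigr => g _; rewrite !rmorphM mulrA.
  rewrite exchange_big /=; apply: eq_bigr => g _.
  by rewrite [RHS]mxE /Gg mxE /peval /mmap -big_distrr.
(* Each conjugate of [G] still takes values on the line of [f y]: an extension [t] of the inverse of
   [g] carries its value at [v] to that of [G] at the conjugate of [v], and [f] is equivariant. *)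
have GgP g (y : X) v : hcoord (val y) v -> Gg g v \in val (val (f y)).
  move=> yv; have [t tg] := gal_extension (g^-1)%g.
  have tG : map_mx t (Gg g v) = pevals j G (map_mx t v).
    apply/colP => i; rewrite !mxE /peval /mmap rmorph_sum; apply: eq_bigr => l _.
    rewrite rmorphM /= tg -galMv mulgV gal_id; congr (_ * _).
    by rewrite /mmap1 rmorph_prod; apply: eq_bigr => b _; rewrite rmorphXn mxE.
  have [->|nz] := eqVneq (Gg g v) 0; first exact: mem0v.
  have [y' yy'] := conj_point_exists t (val y).
  have Xy' : X y'.
    by apply: (defined_over_conj dX tg yy'); apply: set_mem; apply: valP.
  pose z : X := SigSub (mem_set Xy').
  have h1 : hcoord (val (f z)) (map_mx t (Gg g v)).
    rewrite tG; apply: Gf; first exact: yy'.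
    by rewrite -tG map_mx_eq0.
  have [y2 y2v] := proj_point nz.
  suff -> : val (f y) = y2 by case/andP: y2v.
  apply: (@conj_point_inj _ _ t _ _ (val (f z))); first exact: (eqf t _ tg).
  exact: conj_point_hcoord y2v h1.
have [v xv] := hcoord_exists (val x).
have [q nzq] : exists q, pevals iota (Gi q) v != 0.
  apply: contrapT => h; have := Gx v xv; apply/negP/negPn/eqP.
  have -> : pevals j G v = \sum_q j (mu q) *: pevals iota (Gi q) v.
    under eq_bigr do rewrite GiE scaler_sumr.
    rewrite exchange_big /= (bigD1 1%g) //= [X in _ + X]big1 => [|g g1].
      under eq_bigr do rewrite scalerA -rmorphM.
      rewrite -scaler_suml -rmorph_sum dual eqxx rmorph1 scale1r addr0.
      apply/colP => i; rewrite !mxE /peval /mmap; apply: eq_bigr => l _ /=.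
      by rewrite gal_id.
    under eq_bigr do rewrite scalerA -rmorphM.
    by rewrite -scaler_suml -rmorph_sum dual (negPf g1) rmorph0 scale0r.
  rewrite big1 // => q _; have [->|nz] := eqVneq (pevals iota (Gi q) v) 0.
    by rewrite scaler0.
  by case: h; exists q.
have hGi i : Gi q i \is d.-homog by apply: dhomog_push.
exists d, (Gi q); split=> // [w xw|y w yw nz].
  have [c c0 ->] := hcoord_scale xv xw.
  have -> : pevals iota (Gi q) (c *: v) = c ^+ d *: pevals iota (Gi q) v.
    by apply/colP => i; rewrite !mxE (peval_scale _ _ _ (hGi i)).
  by rewrite scaler_eq0 negb_or expf_neq0.
rewrite /hcoord nz GiE; apply: memv_suml => g _.
by apply: memvZ; apply: GgP.
Qed.

End Descent.

Lemma eigen_all_scalar (F : fieldType) n (P : 'M[F]_n.+1) :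
  (forall w : 'cV_n.+1, w != 0 -> exists c, P *m w = c *: w) -> P = (P 0 0)%:M.
Proof.
move=> eP; have nz (i : 'I_n.+1) : delta_mx i 0 != 0 :> 'cV[F]_n.+1.
  by apply/eqP => /colP/(_ i); rewrite !mxE !eqxx => /eqP; rewrite oner_eq0.
have off i l : i != l -> P i l = 0.
  move=> il; have [c] := eP _ (nz l); rewrite -colE => /colP/(_ i).
  by rewrite !mxE (negPf il) mulr0.
apply/matrixP => i l; rewrite mxE; have [<-|il] := eqVneq i l; last exact: off.
rewrite mulr1n; have [->//|i0] := eqVneq i 0.
have [|c] := eP (delta_mx i 0 + delta_mx 0 0).
  apply/eqP => /colP/(_ i); rewrite !mxE !eqxx (negPf i0) addr0 => /eqP.
  by rewrite oner_eq0.
rewrite mulmxDr -!colE => /colP E; have := E i; have := E 0.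
rewrite !mxE !eqxx (negPf i0) eq_sym (negPf i0) (off i 0) // (off 0 i) 1?eq_sym //.
by rewrite !addr0 !add0r !mulr1 => -> ->.
Qed.

(** Every vector is an eigenvector of the product of the inverse of [M] with [N], so that product is
    scalar. *)
Lemma proportional_mx (F : fieldType) n (M N : 'M[F]_n.+1) : M \in unitmx ->
  (forall w : 'cV_n.+1, w != 0 -> exists c, N *m w = c *: (M *m w)) ->
    exists c, N = c *: M.
Proof.
move=> uM h; exists ((invmx M *m N) 0 0).
rewrite -mul_mx_scalar -eigen_all_scalar ?mulKVmx // => w w0.
have [c cE] := h w w0; exists c.
by rewrite -mulmxA cE -scalemxAr mulKmx.
Qed.

(** The scalar lies a priori in K, but it is a quotient of coordinates coming from L. *)
Lemma hcoord_map_scale (L K : fieldType) (j : {rmorphism L -> K}) n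
    (x : proj K n) (u w : 'cV[L]_n.+1) :
  hcoord x (map_mx j u) -> hcoord x (map_mx j w) -> exists c, w = c *: u.
Proof.
move=> xu xw; have [c c0 wE] := hcoord_scale xu xw.
have /andP[] := xu; rewrite map_mx_eq0 => /matrix0Pn[i [z]]; rewrite ord1 => ui _.
exists (w i 0 / u i 0); apply: (map_mx_inj (f := j)); rewrite map_mxZ wE.
congr (_ *: _); have /colP/(_ i) := wE; rewrite !mxE fmorph_div => ->.
by rewrite mulfK // fmorph_eq0.
Qed.

Lemma hcoord_proportional (K : fieldType) n (x : proj K n) v c w :
  hcoord x v -> c != 0 -> w = c *: v -> hcoord x w.
Proof. by move=> xv c0 ->; apply: hcoordZ. Qed.

Lemma P2_linear_map (L K : fieldType) (j : {rmorphism L -> K}) (B : 'M[L]_3) :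
  B \in unitmx -> exists2 f : P2 K -> P2 K, morphism_over j f &
    forall (x : P2 K) v, hcoord (val x) v -> hcoord (val (f x)) (map_mx j B *m v).
Proof.
move=> uB; have ujB : map_mx j B \in unitmx by rewrite map_unitmx.
have nz (v : 'cV_3) : v != 0 -> map_mx j B *m v != 0.
  move=> v0; apply: contraNneq v0 => h.
  by rewrite -[v](mulKmx ujB) h mulmx0.
have ex (x : P2 K) : exists y : P2 K, forall v, hcoord (val x) v ->
    hcoord (val y) (map_mx j B *m v).
  have [v xv] := hcoord_exists (val x); have /andP[v0 _] := xv.
  have [y yv] := P2_point (nz v v0); exists y => w xw.
  by have [c c0 ->] := hcoord_scale xv xw; rewrite -scalemxAr; apply: hcoordZ.
have [f fE] := choice ex; exists f => // x.
pose G i : {mpoly L[3]} := \sum_l B i l *: 'X_l.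
have GE v : pevals j G v = map_mx j B *m v.
  apply/colP => i; rewrite !mxE /peval rmorph_sum; apply: eq_bigr => l _.
  by rewrite /= mmapZ mmapX mmap1U !mxE.
exists 1%N, G; split=> [i|v /andP[v0 _]|y v yv _]; rewrite ?GE;
  [|exact: nz|exact: fE].
by apply: rpred_sum => l _; apply: dhomogZ; rewrite dhomogX /= mdeg1.
Qed.

Lemma P2_linear_isomorphism (L K : fieldType) (j : {rmorphism L -> K}) (B :
  'M[L]_3) :
  B \in unitmx -> exists l : isomorphism j (P2 K) (P2 K), forall (x : P2 K) v,
    hcoord (val x) v -> hcoord (val (l x)) (map_mx j B *m v).
Proof.
move=> uB; have uV : invmx B \in unitmx by rewrite unitmx_inv.
have [l ml lE] := P2_linear_map j uB; have [l' ml' l'E] := P2_linear_map j uV.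
have lK : cancel l l'.
  move=> p; apply: val_inj; have [v pv] := hcoord_exists (val p).
  have := l'E _ _ (lE _ _ pv); rewrite mulmxA -map_mxM mulVmx // map_mx1 mul1mx.
  by move=> h; apply: hcoord_inj h pv.
have l'K : cancel l' l.
  move=> p; apply: val_inj; have [v pv] := hcoord_exists (val p).
  have := lE _ _ (l'E _ _ pv); rewrite mulmxA -map_mxM mulmxV // map_mx1 mul1mx.
  by move=> h; apply: hcoord_inj h pv.
by exists (Isomorphism lK l'K ml ml').
Qed.

(** * Automorphisms of S as invertible elements of D, and their determinants *)

Section SBDeterminant.
Variables (k : fieldType) (K : closedFieldType) (iota : {rmorphism k -> K}).
Variables (n : nat) (S : set (proj K n)).
Variables (L : splittingFieldType k) (j : {rmorphism L -> K}).
Variables (phi : isomorphism j S (P2 K)) (A_ : gal_of {:L} -> 'M[L]_3).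
Hypotheses (K_closure : algebraic_closure iota) (S_defined : defined_over iota S)
  (S_nontrivial : ~ trivial_Severi_Brauer iota S) (L_galois : galois 1 {:L})
  (L_in_K : forall a : k, j (a%:A) = iota a) (A_descent : descent_matrices phi A_).
Implicit Types (g h : gal_of {:L}) (s t : {rmorphism K -> K}) (alpha beta :
  varAut iota S).
Local Notation extends := (extends j).
Local Notation twisted := (twisted A_).
Local Notation represents := (represents phi A_).

Lemma descent_unit g : A_ g \in unitmx.
Proof. by have [] := A_descent (mem_gal1 g). Qed.

Lemma phi_conj s g (x y : S) v : extends s g -> conj_point s (val x) (val y) ->
  hcoord (val (phi x)) v -> hcoord (val (phi y)) (map_mx j (A_ g) *m map_mx s v).
Proof.
move=> sg xy xv; have [_ H] := A_descent (mem_gal1 g).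
exact: (H s sg x y xy v xv).
Qed.

Lemma map_extends s g p q (M : 'M[L]_(p, q)) : extends s g ->
  map_mx s (map_mx j M) = map_mx j (map_mx g M).
Proof. by move=> sg; apply/matrixP => a b; rewrite !mxE sg. Qed.

Lemma conj_in n' (X : set (proj K n')) s g (x : X) : defined_over iota X ->
  extends s g ->
  exists y : X, conj_point s (val x) (val y).
Proof.
move=> dX sg; have [y xy] := conj_point_exists s (val x).
have Xy : X y.
  by apply: (defined_over_conj L_in_K dX sg xy); apply: set_mem; apply: valP.
by exists (SigSub (mem_set Xy)).
Qed.

Lemma P2_defined : defined_over iota (P2 K).
Proof. by exists [::]. Qed.

Lemma phi_surj (v : 'cV[K]_3) : v != 0 -> exists x : S, hcoord (val (phi x)) v.
Proof.
by move=> /P2_point[p pv]; exists (iso_inv phi p); rewrite iso_invK.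
Qed.

Lemma phi_inj : injective phi.
Proof. exact: can_inj (iso_funK phi). Qed.

(** Lets a conjugate point have any prescribed L-rational coordinates [w], as needed to test
    proportionality of matrices. *)
Lemma gal_preimage g (w : 'cV[L]_3) : w != 0 ->
  exists2 u : 'cV[L]_3, map_mx g u = w & map_mx j u != 0.
Proof.
move=> w0; exists (map_mx (g^-1)%g w); first by rewrite -map_galM mulVg map_gal1.
by rewrite !map_mx_eq0.
Qed.

(** Conjugating a point by [t] and then by [s] is conjugating it by their composite; both sides give
    coordinates of the same image, at every L-rational point. *)
Lemma descent_cocycle g h :
  exists c, A_ (h * g)%g = c *: (A_ g *m map_mx g (A_ h)).
Proof.
apply: proportional_mx; first by rewrite unitmx_mul map_unitmx !descent_unit.
move=> w w0; have [u uw ju] := gal_preimage (h * g)%g w0.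
have [s sg] := gal_extension K_closure L_in_K g.
have [t th] := gal_extension K_closure L_in_K h.
have sth : extends (s \o t) (h * g)%g by move=> a /=; rewrite th sg galMv.
have [x xu] := phi_surj ju.
have [y xy] := conj_in x S_defined th; have [z yz] := conj_in y S_defined sg.
have xz : conj_point (s \o t) (val x) (val z).
  by move=> v xv; rewrite map_mx_comp; apply: yz; apply: xy.
have h1 := phi_conj sg yz (phi_conj th xy xu).
have h2 := phi_conj sth xz xu.
move: h1 h2; rewrite map_mxM !(map_extends _ th) !(map_extends _ sg).
rewrite (map_extends _ sth) uw -map_galM uw -!map_mxM mulmxA.
exact: hcoord_map_scale.
Qed.

Lemma morphism_equivariant n' m' (X : set (proj K n')) (Y : set (proj K m')) (f :
  X -> Y) :
  morphism_over iota f -> equivariant j f.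
Proof.
move=> mf s g sg x y xy; have [d [G [_ Gx Gf]]] := mf x.
have [v xv] := hcoord_exists (val x).
have E : pevals iota G (map_mx s v) = map_mx s (pevals iota G v).
  by apply/colP => i; rewrite !mxE (peval_iota_conj L_in_K _ _ sg).
apply: (conj_point_hcoord (Gf x v xv (Gx v xv))); rewrite -E; apply: Gf.
  exact: xy.
by rewrite E map_mx_eq0 Gx.
Qed.

Lemma equivariant_inv n' m' (X : set (proj K n')) (Y : set (proj K m'))
    (f : X -> Y) (f' : Y -> X) : cancel f f' -> cancel f' f ->
  defined_over iota X -> equivariant j f -> equivariant j f'.
Proof.
move=> fK f'K dX ef s g sg p q pq; have [y xy] := conj_in (f' p) dX sg.
have := ef s g sg _ _ xy; rewrite f'K => pfy.
have -> : f' q = y by rewrite -[y]fK; congr f'; apply: val_inj;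
  apply: conj_point_fun pq pfy.
exact: xy.
Qed.

Lemma representsP alpha A : represents alpha A <->
  [/\ A \in unitmx, forall (x : S) v, hcoord (val (phi x)) v ->
        hcoord (val (phi (alpha x))) (map_mx j A *m v) & twisted A].
Proof.
split=> [[uA rA tA]|[uA rA tA]]; split=> // g; last first.
  by move=> _; apply: twisted_conj => //; apply: descent_unit.
by rewrite (tA g (mem_gal1 g)) !mulmxA mulmxV ?mul1mx ?descent_unit.
Qed.

(** Equivariance of [alpha] makes its matrix commute with the twisted action up to scalars [c g].
    These form a cocycle, and Hilbert 90 in size one finds the multiple of the matrix lying in D. *)
Lemma represents_exists alpha : exists A, represents alpha A.
Proof.
pose f p := phi (alpha (iso_inv phi p)).
pose f' p := phi (iso_inv alpha (iso_inv phi p)).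
have mj (b : varAut iota S) : morphism_over j b.
  by apply: (morphism_over_extension L_in_K); apply: iso_fun_morphism.
have mf (b : varAut iota S) : morphism_over j (fun p => phi (b (iso_inv phi p))).
  apply: (morphism_over_comp (g := phi) (f := fun p => b (iso_inv phi p))).
    exact: iso_fun_morphism.
  by apply: morphism_over_comp (mj b) _; apply: iso_inv_morphism.
have fK : cancel f f' by move=> p; rewrite /f /f' !iso_funK iso_invK.
have [A uA AE] := P2_automorphism_linear fK (mf alpha) (mf (varAut_inv alpha)).
have {}AE (x : S) v : hcoord (val (phi x)) v ->
    hcoord (val (phi (alpha x))) (map_mx j A *m v).
  by move=> /AE; rewrite /f iso_funK.
have ex_c g : exists c, A_ g *m map_mx g A = c *: (A *m A_ g).
  apply: proportional_mx; first by rewrite unitmx_mul uA descent_unit.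
  move=> w w0; have [u uw ju] := gal_preimage g w0.
  have [s sg] := gal_extension K_closure L_in_K g.
  have [x xu] := phi_surj ju; have [y xy] := conj_in x S_defined sg.
  have axy := morphism_equivariant (iso_fun_morphism alpha) sg xy.
  have h1 := AE _ _ (phi_conj sg xy xu); have h2 := phi_conj sg axy (AE _ _ xu).
  move: h1 h2; rewrite map_mxM !(map_extends _ sg) uw -!map_mxM !mulmxA.
  exact: hcoord_map_scale.
have [c cE] := choice ex_c.
have uAA g : A *m A_ g \in unitmx by rewrite unitmx_mul uA descent_unit.
have c0 g : c g != 0.
  apply/eqP => z; have : A_ g *m map_mx g A \in unitmx.
    by rewrite unitmx_mul descent_unit map_unitmx.
  by rewrite cE z scale0r unitmxE det0 unitr0.
(* The scalar [a] of the projective cocycle occurs on both sides and cancels, so [c] is a true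
   cocycle. *)
have cc g h : c (h * g)%g = c g * g (c h).
  have [a aE] := descent_cocycle g h.
  have e1 : A_ (h * g)%g *m map_mx (h * g)%g A =
    (c g * g (c h)) *: (A *m A_ (h * g)%g).
    rewrite aE -scalemxAl map_galM -mulmxA -map_mxM cE map_mxZ map_mxM.
    rewrite -!scalemxAr mulmxA cE -scalemxAl !scalerA -mulmxA.
    by congr (_ *: _); ring.
  move: e1; rewrite cE => /eqP; rewrite -subr_eq0 -scalerBl scaler_eq0.
  have -> : (A *m A_ (h * g)%g == 0) = false.
    apply/negP => /eqP z; have := uAA (h * g)%g.
    by rewrite z unitmxE det0 unitr0.
  by rewrite orbF subr_eq0 => /eqP.
have [g|g h|B uB BE] := @Hilbert90_mx _ _ 1 (fun g => (c g)%:M).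
- by rewrite unitmxE det_scalar1 unitfE.
- by rewrite map_scalar_mx -scalar_mxM cc.
pose b := B 0 0.
have b0 : b != 0 by move: uB; rewrite unitmxE det_mx11 unitfE.
have bE g : c g * g b = b.
  by have /matrixP/(_ 0 0) := BE g; rewrite mul_scalar_mx !mxE.
exists (b *: A); apply/representsP; split=> [|x v xv|g].
- by rewrite unitmxZ // unitfE.
- by rewrite map_mxZ -scalemxAl; apply: hcoordZ; rewrite ?fmorph_eq0 //; apply: AE.
- by rewrite map_mxZ -scalemxAr cE scalerA mulrC bE scalemxAl.
Qed.

(** Being twisted is exactly what makes the map with matrix [A] in the coordinates [phi]
    equivariant; it and its inverse then descend to k. *)
Lemma represented A : twisted A -> A \in unitmx -> exists alpha, represents alpha A.
Proof.
move=> tA uA; have [l lE] := P2_linear_isomorphism j uA.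
pose f x := iso_inv phi (l (phi x)); pose f' x := iso_inv phi (iso_inv l (phi x)).
have fK : cancel f f' by move=> x; rewrite /f /f' iso_invK !iso_funK.
have f'K : cancel f' f by move=> x; rewrite /f /f' !iso_invK iso_funK.
have fE (x : S) v : hcoord (val (phi x)) v ->
  hcoord (val (phi (f x))) (map_mx j A *m v).
  by move=> xv; rewrite /f iso_invK; apply: lE.
have mf : morphism_over j f.
  apply: morphism_over_comp (iso_inv_morphism phi) _.
  exact: morphism_over_comp (iso_fun_morphism l) (iso_fun_morphism phi).
have mf' : morphism_over j f'.
  apply: morphism_over_comp (iso_inv_morphism phi) _.
  exact: morphism_over_comp (iso_inv_morphism l) (iso_fun_morphism phi).
have ef : equivariant j f.
  move=> s g sg x y xy; have [z xz] := conj_in (f x) S_defined sg.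
  suff -> : f y = z by [].
  apply: phi_inj; apply: val_inj; have [v xv] := hcoord_exists (val (phi x)).
  have h1 := fE _ _ (phi_conj sg xy xv); have h2 := phi_conj sg xz (fE _ _ xv).
  apply: hcoord_inj h1 _; move: h2.
  by rewrite map_mxM (map_extends _ sg) !mulmxA -!map_mxM tA.
have ef' := equivariant_inv fK f'K S_defined ef.
exists (Isomorphism fK f'K
  (morphism_descent K_closure L_galois L_in_K S_defined mf ef)
  (morphism_descent K_closure L_galois L_in_K S_defined mf' ef')).
by apply/representsP.
Qed.

Lemma twisted_division d : twisted d -> d != 0 -> d \in unitmx.
Proof.
move=> td d0; apply: contraT => nd; case: S_nontrivial.
have [B [c [uB BE]]] := twisted_singular descent_unit descent_cocycle td d0 nd.
have uV : invmx B \in unitmx by rewrite unitmx_inv.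
have [l lE] := P2_linear_isomorphism j uV.
pose f x := l (phi x); pose f' p := iso_inv phi (iso_inv l p).
have fK : cancel f f' by move=> x; rewrite /f /f' !iso_funK.
have f'K : cancel f' f by move=> x; rewrite /f /f' !iso_invK.
have mf : morphism_over j f.
  exact: morphism_over_comp (iso_fun_morphism l) (iso_fun_morphism phi).
have mf' : morphism_over j f'.
  exact: morphism_over_comp (iso_inv_morphism phi) (iso_inv_morphism l).
have ef : equivariant j f.
  move=> s g sg x y xy; have [v xv] := hcoord_exists (val (phi x)).
  have h1 := lE _ _ (phi_conj sg xy xv).
  apply: (conj_point_hcoord (lE _ _ xv)).
  have [c0 cE] := BE g; have ugB : map_mx g B \in unitmx by rewrite map_unitmx.
  (* In the coordinates given by [phi] followed by the inverse of [B], the descent matrices become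
     scalars: conjugation is the standard one on P^2. *)
  have E : invmx B *m A_ g = c g *: invmx (map_mx g B).
    apply: (can_inj (mulmxK ugB)); rewrite -scalemxAl mulVmx // -mulmxA cE.
    by rewrite -scalemxAr mulVmx.
  apply: (hcoord_proportional (c := j (c g)^-1) h1);
    rewrite ?fmorph_eq0 ?invr_eq0 //.
  rewrite map_mxM (map_extends _ sg) mulmxA -map_mxM E map_mxZ -scalemxAl scalerA.
  by rewrite -rmorphM mulVf // rmorph1 scale1r map_invmx.
have ef' := equivariant_inv fK f'K S_defined ef.
split; exact: (Isomorphism fK f'K
  (morphism_descent K_closure L_galois L_in_K S_defined mf ef)
  (morphism_descent K_closure L_galois L_in_K P2_defined mf' ef')).
Qed.

Lemma representsM alpha beta A B : represents alpha A -> represents beta B ->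
  represents (alpha * beta)%g (A *m B).
Proof.
move=> /representsP[uA rA tA] /representsP[uB rB tB]; apply/representsP; split.
- by rewrite unitmx_mul uA.
- by move=> x v xv; rewrite map_mxM -mulmxA; apply: rA; apply: rB.
- exact: twistedM.
Qed.

Lemma represents1 : represents (1%g : varAut iota S) 1%:M.
Proof.
apply/representsP; split; [exact: unitmx1| |exact: twisted1].
by move=> x v xv; rewrite map_mx1 mul1mx.
Qed.

Lemma represents_inj alpha beta A c : c != 0 ->
  represents alpha A -> represents beta (c *: A) -> alpha = beta.
Proof.
move=> c0 /representsP[_ rA _] /representsP[_ rB _]; apply: varAut_ext => x.
apply: phi_inj; apply: val_inj; have [v xv] := hcoord_exists (val (phi x)).
have := rB x v xv; rewrite map_mxZ -scalemxAl => h; apply: hcoord_inj h.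
by apply: hcoordZ; rewrite ?fmorph_eq0 //; apply: rA.
Qed.

Lemma representsV alpha A : represents alpha A -> represents alpha^-1%g (invmx A).
Proof.
move=> rA; have /representsP[uA _ tA] := rA.
have uV : invmx A \in unitmx by rewrite unitmx_inv.
have [beta rB] := represented (twistedV tA : twisted (invmx A)) uV.
suff -> : (alpha^-1)%g = beta by [].
have := representsM rA rB; rewrite mulmxV // => r1.
have ab1 : (1 = alpha * beta)%g.
  by apply: (represents_inj (oner_neq0 _) represents1); rewrite scale1r.
by rewrite -[RHS](mulKg alpha) -ab1 mulg1.
Qed.

Lemma represents_unique alpha A B : represents alpha A -> represents alpha B ->
  exists2 a : k, a != 0 & B = a%:A *: A.
Proof.
move=> /representsP[uA rA tA] /representsP[uB rB tB].
have [|c BE] := @proportional_mx _ _ A B uA.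
  move=> w w0; have [|x xw] := @phi_surj (map_mx j w); first by rewrite map_mx_eq0.
  move: (rA _ _ xw) (rB _ _ xw); rewrite -!map_mxM; exact: hcoord_map_scale.
have c0 : c != 0.
  by apply/eqP => z; move: uB; rewrite BE z scale0r unitmxE det0 unitr0.
have [|a aE] := galois_fixedP (x := c) L_galois.
  move=> g; have := tB g; rewrite BE map_mxZ -scalemxAr tA -scalemxAl => /eqP.
  rewrite -subr_eq0 -scalerBl scaler_eq0.
  have -> : (A *m A_ g == 0) = false.
    apply/negP => /eqP z; have : A *m A_ g \in unitmx.
      by rewrite unitmx_mul uA descent_unit.
    by rewrite z unitmxE det0 unitr0.
  by rewrite orbF subr_eq0 => /eqP.
exists a; last by rewrite BE aE.
by apply: contraNneq c0 => z; rewrite aE z scale0r.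
Qed.

Lemma represents_det alpha A : represents alpha A ->
  exists c : fstar k, \det A = (val c)%:A.
Proof.
move=> /representsP[uA _ tA].
have [a aE] := twisted_det descent_unit L_galois tA.
have a0 : a != 0.
  by apply/eqP => z; move: uA; rewrite unitmxE aE z scale0r unitr0.
by exists (exist _ a a0).
Qed.

(** The class does not depend on the representative: replacing [A] by [a%:A *: A] multiplies the
    determinant by the cube of [a]. *)
Lemma SB_detE alpha A (c : fstar k) : represents alpha A -> \det A = (val c)%:A ->
  SB_det phi A_ alpha = quotMap (cubes k) c.
Proof.
move=> rA dA; apply: xget_unique; first by exists A, c.
move=> _ [B [c' [rB dB ->]]]; apply/quot_mapP.
have [a a0 BE] := represents_unique rA rB.
pose y : fstar k := exist _ a a0; exists y.
suff -> : c' = (y ^+ 3 * c)%g by rewrite mulgK.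
apply: val_inj; apply: (@alg_inj k L).
rewrite -dB BE detZ dA.
have -> : (a%:A : L) ^+ 3 = (a ^+ 3)%:A by rewrite exprZn expr1n.
by rewrite -scalerAl mul1r scalerA; congr (_ *: _).
Qed.

Lemma SB_det_rep alpha : exists A (c : fstar k),
  [/\ represents alpha A, \det A = (val c)%:A
    & SB_det phi A_ alpha = quotMap (cubes k) c].
Proof.
have [A rA] := represents_exists alpha; have [c cE] := represents_det rA.
by exists A, c; split=> //; apply: SB_detE cE.
Qed.

Lemma SB_detM alpha beta :
  SB_det phi A_ (alpha * beta)%g = (SB_det phi A_ alpha * SB_det phi A_ beta)%g.
Proof.
have [A [a [rA dA ->]]] := SB_det_rep alpha.
have [B [b [rB dB ->]]] := SB_det_rep beta.
rewrite (SB_detE (c := (a * b)%g) (representsM rA rB)); first exact: quot_mapM.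
by rewrite det_mulmx dA dB -scalerAl mul1r scalerA.
Qed.

Lemma SB_det1 : SB_det phi A_ (1%g : varAut iota S) = 1%g.
Proof.
rewrite (SB_detE (c := 1%g) represents1) //.
by rewrite det1 scale1r.
Qed.

Lemma SB_detV alpha : SB_det phi A_ alpha^-1%g = ((SB_det phi A_ alpha)^-1)%g.
Proof.
by apply: (mulgI (SB_det phi A_ alpha)); rewrite -SB_detM !mulgV SB_det1.
Qed.

Lemma cube_quot_mulC (a b : quotGroup (cubes k)) : (a * b = b * a)%g.
Proof.
rewrite -[a]quot_mapK -[b]quot_mapK.
rewrite -[LHS]quot_mapM -[RHS]quot_mapM; congr quotMap; exact: fstar_mulC.
Qed.

Lemma SB_det_commutator alpha :
  commutator_subgroup alpha -> SB_det phi A_ alpha = 1%g.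
Proof.
move=> h; apply: (h (fun x => SB_det phi A_ x = 1%g)).
split=> [|a b ha hb|a ha].
- exact: SB_det1.
- by rewrite SB_detM ha hb mulg1.
- by rewrite SB_detV ha invg1.
move=> a b; rewrite /commg /conjg !(SB_detM, SB_detV).
by rewrite [((SB_det _ _ b)^-1 * _)%g]cube_quot_mulC mulgK mulVg.
Qed.

Lemma SB_det_kernel alpha :
  SB_det phi A_ alpha = 1%g -> commutator_subgroup alpha.
Proof.
have [A [c [rA dA ->]]] := SB_det_rep alpha.
move=> /quot_mapP; rewrite invg1 mulg1 => -[y cy].
(* The determinant is the cube of [y], so division by [y] gives a representative of determinant
   exactly 1. *)
pose b : L := ((val y)^-1)%:A.
have y0 : val y != 0 := valP y.
have b0 : b != 0 by rewrite scaler_eq0 invr_eq0 (negPf y0) oner_eq0.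
have /representsP[uA rA' tA] := rA.
pose a := b *: A.
have ta : twisted a.
  by rewrite /a -mul_scalar_mx; apply: twistedM => //; apply: twisted_alg.
have ra : represents alpha a.
  apply/representsP; split=> //; first by rewrite unitmxZ ?unitfE.
  by move=> x v xv; rewrite map_mxZ -scalemxAl; apply: hcoordZ;
    rewrite ?fmorph_eq0 //; apply: rA'.
have da : \det a = 1.
  have -> : \det a = b ^+ 3 * \det A by rewrite detZ.
  rewrite dA cy /b exprZn expr1n -scalerAl mul1r scalerA exprVn.
  have -> : val (y ^+ 3)%g = val y ^+ 3 by rewrite !exprS expr0 mulr1.
  by rewrite mulVf ?scale1r // expf_neq0.
(* A scalar representative means [alpha] is the identity; only the other case calls for the division
   algebra. *)
have [[e aE]|nsc] := pselect (exists e, a = e%:M).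
  have -> : alpha = 1%g.
    have e0 : e != 0.
      by apply/eqP => z; move/eqP: da; rewrite aE z raddf0 det0 eq_sym oner_eq0.
    apply/esym; apply: (represents_inj e0 represents1).
    by rewrite scalemx1 -aE.
  by have [] := commutator_subgroup_subgroup (varAut iota S).
have [|x [z [tx tz ux uz xz]]] :=
  twisted_SL_commutator descent_unit descent_cocycle L_galois twisted_division ta da.
  by move=> e ae; apply: nsc; exists e.
have [xi rx] := represented tx ux; have [zeta rz] := represented tz uz.
have rc := representsM (representsV rx)
  (representsM (representsV rz) (representsM rx rz)).
have -> : alpha = [~ xi, zeta]%g.
  apply: (represents_inj (oner_neq0 _) ra); rewrite scale1r xz -!mulmxA.
  exact: rc.
by move=> H _ hH; apply: hH.
Qed.

End SBDeterminant.

Theorem lemma6p2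
  (k : fieldType) (K : closedFieldType) (iota : {rmorphism k -> K})
  (n : nat) (S : set (proj K n))
  (L : splittingFieldType k) (j : {rmorphism L -> K})
  (phi : isomorphism j S (P2 K)) (A_ : gal_of {:L} -> 'M[L]_3)
  (k_perfect : perfect_field k)
  (K_closure : algebraic_closure iota)
  (S_SB : Severi_Brauer_surface iota S)
  (S_nontrivial : ~ trivial_Severi_Brauer iota S)
  (L_galois : galois 1 {:L})
  (L_in_K : forall a : k, j (a%:A) = iota a)
  (A_descent : descent_matrices phi A_) :
  let det : varAut iota S -> quotGroup (cubes k) :=
    SB_det phi A_ in
  (forall alpha : varAut iota S,
     det alpha = 1%g <-> commutator_subgroup alpha) /\
  (exists f : {multiplicative abelianization (varAut iota S) ->
                               quotGroup (cubes k)},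
     [/\ forall alpha : varAut iota S,
           f (quotMap (derived_subgroup (varAut iota S)) alpha) = det alpha,
         injective f
       & range f = range det]).
Proof.
move=> det; have [S_defined _] := S_SB.
have kerE alpha : det alpha = 1%g <-> commutator_subgroup alpha.
  by split; [apply: SB_det_kernel | apply: SB_det_commutator].
have detM alpha beta : det (alpha * beta)%g = (det alpha * det beta)%g.
  exact: SB_detM.
have detV alpha : det alpha^-1%g = ((det alpha)^-1)%g by exact: SB_detV.
split=> //.
(* Evaluating on a chosen representative is harmless: two representatives differ by an element of
   the commutator subgroup, where [det] is trivial. *)
pose f (q : abelianization (varAut iota S)) := det (generic_quotient.repr q).
have fE alpha : f (quotMap (derived_subgroup (varAut iota S)) alpha) = det alpha.
  have /kerE := repr_quotMap (derived_subgroup (varAut iota S)) alpha.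
  by rewrite detM detV => /(canRL (mulgVK _)); rewrite mul1g.
have fM : {morph f : a b / (a * b)%g}.
  by move=> a b; rewrite -detM; apply: fE.
pose F : {multiplicative abelianization (varAut iota S) -> quotGroup (cubes k)} :=
  HB.pack f (isMultiplicative.Build _ _ f fM).
exists F; split=> [alpha|a b /= fab|].
- exact: fE.
- rewrite -[a]quot_mapK -[b]quot_mapK; apply/quot_mapP/kerE.
  by rewrite detM detV -/(f a) -/(f b) fab mulgV.
- apply/seteqP; split=> [_ [a _ <-]|_ [alpha _ <-]]; first
  by exists (generic_quotient.repr a).
  by exists (quotMap (derived_subgroup (varAut iota S)) alpha) => //; apply: fE.
Qed.
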